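(* The problem SATISFACTION for non-oblivious models corresponding to strong hierarchical influence games is solvable in polynomial time. That is, there is a polynomial time algorithm that, given a strong hierarchical influence game $\Gamma=(G,f,q,N)$ and an actor $i\in V(G)$, computes $\mathrm{Sat}_{\mathcal{M}^n(\Gamma)}(i)$.
   Context: Graphs are finite, directed, without loops or multiple edges; $P_G(i)=P(i)=\{j\mid (j,i)\in E\}$, $S_G(i)=\{j\mid(i,j)\in E\}$. For a digraph $G$: $\mathtt{L}(G)=\{i\mid P_G(i)=\emptyset, S_G(i)\ne\emptyset\}$, $\mathtt{F}(G)=\{i\mid S_G(i)=\emptyset, P_G(i)\ne\emptyset\}$, $\mathtt{I}(G)=\{i\mid S_G(i)=P_G(i)=\emptyset\}$, $\mathtt{FI}(G)=\mathtt{F}(G)\cup\mathtt{I}(G)$. Strong hierarchical graphs are defined recursively: (1) the graph $I_a$ of $a>0$ isolated vertices is one; (2) if $H_1,H_2$ are vertex-disjoint strong hierarchical graphs, so is their disjoint union $H_1+H_2$; (3) if $H$ is one and $V'\ne\emptyset$ is a set of vertices with $V(H)\cap V'=\emptyset$, so is $H\otimes V'$, the graph with vertex set $V(H)\cup V'$ and edge set $E(H)\cup\{(u,v)\mid u\in\mathtt{FI}(H),v\in V'\}$. An influence graph is a pair $(G,f)$ with $G=(V,E)$ a digraph and $f$ assigning to each vertex a non-negative rational. For $X\subseteq V$, $n=|V|$: $F^0(X)=X$, $F^t(X)=F^{t-1}(X)\cup\{i\in V\mid |P_G(i)\cap F^{t-1}(X)|\ge f(i)\}$ for $1\le t\le n$,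 and $F(X)=F^n(X)$. An influence game is $\Gamma=(G,f,q,N)$ with $(G,f)$ an influence graph, $q$ an integer, $0\le q\le n$, and $N\subseteq V$. It is a strong hierarchical influence game if $G$ is a strong hierarchical graph and $N=\mathtt{L}(G)\cup\mathtt{I}(G)$. The non-oblivious influence model $\mathcal{M}^n(\Gamma)$ (for $f$ positive, i.e. $f(i)>0$ for all $i$) is defined as follows. For $x\in\{0,1\}^n$ let $X(x)=\{i\mid x_i=1\}$, $p_i(x)=|F(X(x)\cap N)\cap P(i)|$, $q_i(x)=|P(i)\setminus F(X(x)\cap N)|$. For $i\in V\setminus N$: $c_i=1$ if $p_i(x)\ge f(i)$ and $q_i(x)<f(i)$; $c_i=0$ if $q_i(x)\ge f(i)$ and $p_i(x)<f(i)$; $c_i=x_i$ otherwise. For $i\in N$: $c_i=1$ if $i\in F(X(x))$, else $c_i=0$. The collective decision function is $C(x)=1$ if $|\{i\in V\mid c_i=1\}|\ge q$ and $C(x)=0$ otherwise. The satisfaction of actor $i$ is $\mathrm{Sat}(i)=|\{x\in\{0,1\}^n\mid C(x)=x_i\}|$. *)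

(* Defs.v *)
From Corelib Require Import BinNums.
From mathcomp Require Import all_boot all_order all_algebra.

Set Implicit Arguments.
Unset Strict Implicit.
Unset Printing Implicit Defensive.

Import GRing.Theory Num.Theory.
Local Open Scope ring_scope.

(* All graphs live on vertex subsets of an ambient finite type [T], so that
   disjoint unions and joins need no relabelling. *)
Record digraph (T : finType) := Digraph {
  vertices : {set T};
  arcs : {set T * T}
}.

Section Digraphs.
Variable T : finType.
Implicit Types (G H : digraph T) (i j : T) (W : {set T}).

Definition is_digraph G : bool :=
  (arcs G \subset setX (vertices G) (vertices G)) &&
  [forall i, (i, i) \notin arcs G].

Definition preds G i : {set T} := [set j | (j, i) \in arcs G].
Definition succs G i : {set T} := [set j | (i, j) \in arcs G].

Definition Lset G : {set T} :=
  [set i in vertices G | (preds G i == set0) && (succs G i != set0)].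
Definition Fset G : {set T} :=
  [set i in vertices G | (succs G i == set0) && (preds G i != set0)].
Definition Iset G : {set T} :=
  [set i in vertices G | (succs G i == set0) && (preds G i == set0)].
Definition FIset G : {set T} := Fset G :|: Iset G.

Inductive strong_hierarchical : digraph T -> Prop :=
| SHisolated W :
    W != set0 -> strong_hierarchical (Digraph W set0)
| SHunion H1 H2 :
    strong_hierarchical H1 -> strong_hierarchical H2 ->
    [disjoint vertices H1 & vertices H2] ->
    strong_hierarchical
      (Digraph (vertices H1 :|: vertices H2) (arcs H1 :|: arcs H2))
| SHjoin H W :
    strong_hierarchical H -> W != set0 -> [disjoint vertices H & W] ->
    strong_hierarchical
      (Digraph (vertices H :|: W) (arcs H :|: setX (FIset H) W)).

End Digraphs.

Record game_data (T : finType) := GameData {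
  graph : digraph T;
  label : T -> rat;
  quota : nat;
  players : {set T}
}.

Section Games.
Variables (T : finType) (Gam : game_data T).
Implicit Types (X : {set T}) (x : {ffun T -> bool}) (i : T).

Let G := graph Gam.
Let f := label Gam.
Let N := players Gam.

(* The game is played by all elements of [T], so that n = #|T|. *)
Definition influence_game : Prop :=
  [/\ vertices G = [set: T],
      is_digraph G,
      forall i, 0 <= f i
    & (quota Gam <= #|T|)%N].

Definition strong_hierarchical_game : Prop :=
  [/\ influence_game, strong_hierarchical G & N = Lset G :|: Iset G].

Definition spread_step X : {set T} :=
  X :|: [set i | f i <= #|preds G i :&: X|%:R].
Definition spread X : {set T} := iter #|T| spread_step X.

Definition ones x : {set T} := [set i | x i].

Definition active_preds x i : nat := #|spread (ones x :&: N) :&: preds G i|.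
Definition inactive_preds x i : nat := #|preds G i :\: spread (ones x :&: N)|.

Definition final_decision x i : bool :=
  let p : rat := (active_preds x i)%:R in
  let q : rat := (inactive_preds x i)%:R in
  if i \in N then i \in spread (ones x)
  else if (f i <= p) && (q < f i) then true
  else if (f i <= q) && (p < f i) then false
  else x i.

Definition collective_decision x : bool :=
  (quota Gam <= #|[set i | final_decision x i]|)%N.

Definition satisfaction i : nat :=
  #|[set x : {ffun T -> bool} | collective_decision x == x i]|.

End Games.

(* The machine model is a variant of Jones's WHILE language: programs with
   finitely many variables holding finite binary trees.  An assignment is
   charged the number of nodes of the tree it stores, so a run of cost [t]
   writes at most [t] nodes in total and can be simulated by a Turing machine,
   copying every stored tree literally, in time polynomial in [t] and the size
   of the input.  Conversely a Turing machine is simulated with polynomial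
   overhead by storing its tape as two lists. *)
Inductive tree : Type := Leaf | Node of tree & tree.

Fixpoint tree_size (a : tree) : nat :=
  if a is Node b c then (tree_size b + tree_size c).+1%N else 1%N.

Inductive expr : Type :=
| ELeaf
| EVar of nat
| ENode of nat & nat
| EHead of nat
| ETail of nat.

Inductive cmd : Type :=
| Assign of nat & expr
| Seq of cmd & cmd
| If of nat & cmd & cmd
| While of nat & cmd.

Definition store := nat -> tree.

Definition update (s : store) (v : nat) (a : tree) : store :=
  fun w => if w == v then a else s w.

Definition eval (e : expr) (s : store) : tree :=
  match e with
  | ELeaf => Leaf
  | EVar v => s v
  | ENode v w => Node (s v) (s w)
  | EHead v => if s v is Node a _ then a else Leaf
  | ETail v => if s v is Node _ b then b else Leaf
  end.

Definition is_node (a : tree) : bool := if a is Node _ _ then true else false.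

(* [exec c s t s'] : started in store [s], the program [c] halts in store [s']
   at total cost [t]. *)
Inductive exec : cmd -> store -> nat -> store -> Prop :=
| ExecAssign v e s :
    exec (Assign v e) s (tree_size (eval e s)) (update s v (eval e s))
| ExecSeq c1 c2 s1 s2 s3 t1 t2 :
    exec c1 s1 t1 s2 -> exec c2 s2 t2 s3 ->
    exec (Seq c1 c2) s1 (t1 + t2)%N s3
| ExecIfNode v c1 c2 s s' t :
    is_node (s v) -> exec c1 s t s' -> exec (If v c1 c2) s t.+1 s'
| ExecIfLeaf v c1 c2 s s' t :
    ~~ is_node (s v) -> exec c2 s t s' -> exec (If v c1 c2) s t.+1 s'
| ExecWhileLeaf v c s :
    ~~ is_node (s v) -> exec (While v c) s 1%N s
| ExecWhileNode v c s1 s2 s3 t1 t2 :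
    is_node (s1 v) -> exec c s1 t1 s2 -> exec (While v c) s2 t2 s3 ->
    exec (While v c) s1 (t1 + t2).+1%N s3.

(* Variable 0 holds the input, and the output at the end of the run. *)
Definition init_store (a : tree) : store := update (fun=> Leaf) 0%N a.

(* [g] restricted to the instances satisfying [dom] is computed, through the
   encodings [encI] and [encO], by one program within a polynomial cost. *)
Definition poly_time_computable (I O : Type) (encI : I -> tree)
    (encO : O -> tree) (dom : I -> Prop) (g : I -> O) : Prop :=
  exists (c : cmd) (P : {poly nat}), forall a : I, dom a ->
    exists (t : nat) (s : store),
      [/\ exec c (init_store (encI a)) t s,
          s 0%N = encO (g a)
        & (t <= P.[tree_size (encI a)])%N].

Definition encode_bool (b : bool) : tree := if b then Node Leaf Leaf else Leaf.

Definition encode_seq (A : Type) (enc : A -> tree) (l : seq A) : tree :=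
  foldr (fun a b => Node (enc a) b) Leaf l.

(* Binary notation, least significant bit first, without leading zeros. *)
Fixpoint bits_of_pos (p : positive) : seq bool :=
  match p with
  | xH => [:: true]
  | xO p' => false :: bits_of_pos p'
  | xI p' => true :: bits_of_pos p'
  end.

Definition bits_of_nat (m : nat) : seq bool :=
  if bin_of_nat m is Npos p then bits_of_pos p else [::].

Definition encode_nat (m : nat) : tree := encode_seq encode_bool (bits_of_nat m).

(* Reduced fraction; labels are non-negative, so no sign is needed. *)
Definition encode_rat (r : rat) : tree :=
  Node (encode_nat `|numq r|%N) (encode_nat `|denq r|%N).

Record sat_instance := SatInstance {
  num_actors : nat;
  inst_game : game_data 'I_num_actors;
  inst_actor : 'I_num_actors
}.

(* Adjacency matrix, labels, quota, characteristic vector of the players, and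
   the actor.  The vertex set is omitted: it is full in an influence game. *)
Definition encode_instance (a : sat_instance) : tree :=
  let Gam := inst_game a in
  let V := enum 'I_(num_actors a) in
  Node (encode_seq (encode_seq encode_bool)
          [seq [seq (i, j) \in arcs (graph Gam) | j <- V] | i <- V])
  (Node (encode_seq encode_rat [seq label Gam i | i <- V])
  (Node (encode_nat (quota Gam))
  (Node (encode_seq encode_bool [seq i \in players Gam | i <- V])
        (encode_nat (inst_actor a))))).

(* Main.v *)
(* The vertices with a given set of predecessors form a class, namely one of
   the sets V' of the construction, and the classes form a forest.  For a graph
   H occurring in the construction of G, let S(H) be the sum, over the
   decisions of the vertices of H, of y ^ (number of active vertices in FI(H))
   times z ^ (number of final decisions 1 in H).  Then S is multiplicative on
   disjoint unions, and S(H (x) V') is determined by the coefficients of the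
   powers of y in S(H): once the number a of active vertices in FI(H) is known,
   the vertices of V' decide independently of each other.  Evaluating at powers
   of 2 that are so large that the coefficients do not overlap turns S(H) into
   a single number with polynomially many bits, whose coefficients are groups
   of its digits, and n rounds of recomputing the number of each class from
   those of its predecessors yield S(G), with the actor's decision fixed to
   either value.  The satisfaction is a sum of coefficients of these two
   numbers. *)

Require Import Defs.
From mathcomp Require Import all_boot all_order all_algebra.
From mathcomp Require Import zify.

Set Implicit Arguments.
Unset Strict Implicit.
Unset Printing Implicit Defensive.

Import Order.TTheory GRing.Theory Num.Theory.
Local Open Scope nat_scope.

(** * Polynomial time *)

(** The input holds only the adjacency matrix, and no construction of G is ever computed from it:
    predecessor sets determine the classes, and induction on the construction occurs in the
    correctness proof alone. As no order for visiting the classes is known, every class is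
    recomputed in every round. The numbers of early rounds may be meaningless, but the number of a
    class depends only on the classes below it and is correct as soon as theirs are. All arithmetic
    is truncated to a fixed number of bits, so meaningless numbers stay short too.

    The widths come from three bounds, for n vertices. There are at most 2 ^ n decision vectors, so
    Z = 2 ^ (n + 1) separates the coefficients in z. A sum of weights is then at most 2 ^ n * Z ^ n
    = Y / 2 for Y = Z ^ (n + 1), so Y separates the coefficients in y. The numbers themselves are at
    most Y ^ n times that, which is B / 2 for the modulus B = Y ^ (n + 1). *)

Class Enc (A : Type) := enc : A -> tree.

#[local] Instance enc_tree : Enc tree := id.
#[local] Instance enc_bool : Enc bool := encode_bool.
(* Unary; the numbers that must be binary are handled as bit lists. *)
#[local] Instance enc_unary : Enc nat := fun n => iter n (Node Leaf) Leaf.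
#[local] Instance enc_seq A {eA : Enc A} : Enc (seq A) := encode_seq enc.
#[local] Instance enc_prod A B {eA : Enc A} {eB : Enc B} : Enc (A * B) :=
  fun p => Node (enc p.1) (enc p.2).

Definition sz A {eA : Enc A} (a : A) : nat := tree_size (enc a).
Arguments sz {A eA} a.

Lemma tree_size_gt0 a : 0 < tree_size a.
Proof. by case: a. Qed.

Lemma sz_gt0 A {eA : Enc A} (a : A) : 0 < sz a.
Proof. exact: tree_size_gt0. Qed.

Lemma sz_pair A B {eA : Enc A} {eB : Enc B} (p : A * B) :
  sz p = (sz p.1 + sz p.2).+1.
Proof. by []. Qed.

Lemma sz_nat (n : nat) : sz n = n.*2.+1.
Proof.
by elim: n => //= n IHn; rewrite /sz /= -[tree_size _]/(sz n) IHn add1n.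
Qed.

Lemma sz_bool (b : bool) : sz b <= 3.
Proof. by case: b. Qed.

Lemma sz_cons A {eA : Enc A} (x : A) l : sz (x :: l) = (sz x + sz l).+1.
Proof. by []. Qed.

Lemma size_sz A {eA : Enc A} (l : seq A) : size l < sz l.
Proof. by elim: l => //= x l IHl; rewrite sz_cons ltnS; lia. Qed.

(** * Polynomial bounds in the size of an encoding *)

Section PolynomialBounds.
Context (A : Type) {eA : Enc A}.
Implicit Types h : A -> nat.

(** A single power is enough: the base is at least 2 because every encoding has a node, so constants
    and sums are absorbed by a larger exponent. *)
Definition pbounded h : Prop := exists k, forall a, h a <= (sz a).+1 ^ k.

Lemma pbounded_le h1 h2 :
  (forall a, h1 a <= h2 a) -> pbounded h2 -> pbounded h1.
Proof. by move=> le12 [k hk]; exists k => a; apply: leq_trans (hk a). Qed.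

Lemma pbounded_const c : pbounded (fun=> c).
Proof.
exists c => a; apply: leq_trans (ltnW (ltn_expl c (ltnSn 1))) _.
by case: c => // c; rewrite leq_exp2r // ltnS sz_gt0.
Qed.

Lemma pbounded_mul h1 h2 :
  pbounded h1 -> pbounded h2 -> pbounded (fun a => h1 a * h2 a).
Proof.
move=> [k1 hk1] [k2 hk2]; exists (k1 + k2) => a.
by rewrite expnD leq_mul.
Qed.

Lemma pbounded_add h1 h2 :
  pbounded h1 -> pbounded h2 -> pbounded (fun a => h1 a + h2 a).
Proof.
move=> b1 b2.
(* This reduces addition to multiplication. *)
apply: (@pbounded_le _ (fun a => 2 * ((h1 a).+1 * (h2 a).+1))) => [a|]; first nia.
have S h : pbounded h -> pbounded (fun a => (h a).+1).
  case=> k hk; exists k.+1 => a; rewrite expnS.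
  have le2 : 2 <= (sz a).+1 by rewrite ltnS sz_gt0.
  apply: leq_trans (leq_mul le2 (leqnn _)).
  have : 0 < (sz a).+1 ^ k by rewrite expn_gt0.
  by have := hk a; lia.
by apply: pbounded_mul (pbounded_const 2) _; apply: pbounded_mul; apply: S.
Qed.

Lemma pbounded_S h : pbounded h -> pbounded (fun a => (h a).+1).
Proof.
by move=> b; apply: (@pbounded_le _ (fun a => 1 + h a)) => //;
  apply: pbounded_add b; apply: pbounded_const.
Qed.

Lemma pbounded_sz : pbounded sz.
Proof. by exists 1 => a; rewrite expn1. Qed.

End PolynomialBounds.

Lemma pbounded_comp A {eA : Enc A} B {eB : Enc B} (f : A -> B) (h : B -> nat) :
  pbounded (fun a => sz (f a)) -> pbounded h -> pbounded (fun a => h (f a)).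
Proof.
move=> /pbounded_S [l hl] [k hk]; exists (l * k) => a.
by apply: leq_trans (hk _) _; rewrite expnM; case: k {hk} => // k; rewrite leq_exp2r.
Qed.

(** * Executions, the variables they write and their cost *)

Fixpoint writes_below b (c : cmd) : bool :=
  match c with
  | Assign v _ => v < b
  | Seq c1 c2 | If _ c1 c2 => writes_below b c1 && writes_below b c2
  | While _ c => writes_below b c
  end.

Lemma writes_below_le b b' c : b <= b' -> writes_below b c -> writes_below b' c.
Proof.
move=> le_b; elim: c => [v e|c1 IH1 c2 IH2|_ c1 IH1 c2 IH2|_ c IH] //=.
- by move/leq_trans; apply.
- by case/andP=> /IH1-> /IH2.
- by case/andP=> /IH1-> /IH2.
Qed.

(** Variables from [b] on are safe storage across a call of [c], so subprograms can be combined
    without renaming their variables. *)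
Lemma exec_frame b c s t s' :
  exec c s t s' -> writes_below b c -> forall v, b <= v -> s' v = s v.
Proof.
elim=> {c s t s'} /=.
- by move=> v e s lt_vb w le_bw; rewrite /update; case: eqP => // ?; lia.
- move=> c1 c2 s1 s2 s3 t1 t2 _ IH1 _ IH2 /andP[w1 w2] v le_bv.
  by rewrite IH2 ?IH1.
- by move=> v c1 c2 s s' t _ _ IH /andP[w1 w2]; apply: IH.
- by move=> v c1 c2 s s' t _ _ IH /andP[w1 w2]; apply: IH.
- by [].
- by move=> v c s1 s2 s3 t1 t2 _ _ IH1 _ IH2 w u le_bu; rewrite IH2 ?IH1.
Qed.

(** An assignment is charged for the tree it stores, so the cost bounds every new tree. Hence
    polynomial-time functions have outputs of polynomial size, which composition requires. *)
Lemma exec_size c s t s' :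
  exec c s t s' -> forall v, tree_size (s' v) <= maxn (tree_size (s v)) t.
Proof.
elim=> {c s t s'}.
- by move=> v e s w; rewrite /update; case: eqP => _; lia.
- by move=> c1 c2 s1 s2 s3 t1 t2 _ IH1 _ IH2 v; have := IH1 v; have := IH2 v; lia.
- by move=> v c1 c2 s s' t _ _ IH u; have := IH u; lia.
- by move=> v c1 c2 s s' t _ _ IH u; have := IH u; lia.
- by move=> v c s _ u; lia.
- move=> v c s1 s2 s3 t1 t2 _ _ IH1 _ IH2 u.
  by have := IH1 u; have := IH2 u; lia.
Qed.

(** Total correctness in the style of Hoare, with a bound on the cost. *)
Definition run c s T (Q : store -> Prop) : Prop :=
  exists t s', [/\ exec c s t s', t <= T & Q s'].

Lemma run_le c s T T' (Q Q' : store -> Prop) :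
  run c s T Q -> T <= T' -> (forall s', Q s' -> Q' s') -> run c s T' Q'.
Proof.
move=> [t [s' [ex le_t Qs']]] leT QQ'; exists t, s'; split=> //.
- exact: leq_trans leT.
- exact: QQ'.
Qed.

Lemma run_frame b c s T Q :
  writes_below b c -> run c s T Q ->
  run c s T (fun s' => Q s' /\ forall v, b <= v -> s' v = s v).
Proof.
move=> wc [t [s' [ex le_t Qs']]]; exists t, s'; split=> //; split=> //.
exact: exec_frame ex wc.
Qed.

Lemma run_assign v e s T (Q : store -> Prop) :
  tree_size (eval e s) <= T -> Q (update s v (eval e s)) -> run (Assign v e) s T Q.
Proof. by move=> le_T Qs; do 2!eexists; split; first exact: ExecAssign. Qed.

Lemma run_seq c1 c2 s T1 T2 Q :
  run c1 s T1 (fun s1 => run c2 s1 T2 Q) -> run (Seq c1 c2) s (T1 + T2) Q.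
Proof.
move=> [t1 [s1 [ex1 le1 [t2 [s2 [ex2 le2 Qs2]]]]]].
by exists (t1 + t2), s2; split; [apply: ExecSeq ex2 | rewrite leq_add | ].
Qed.

Lemma run_if v c1 c2 s T Q :
  (if is_node (s v) then run c1 s T Q else run c2 s T Q) ->
  run (If v c1 c2) s T.+1 Q.
Proof.
case: ifPn => nv [t [s' [ex le_t Qs']]]; exists t.+1, s'; split=> //.
- exact: ExecIfNode.
- exact: ExecIfLeaf.
Qed.

Lemma run_while_leaf v c s T (Q : store -> Prop) :
  s v = Leaf -> 0 < T -> Q s -> run (While v c) s T Q.
Proof.
move=> sv T0 Qs; exists 1, s; split=> //; apply: ExecWhileLeaf.
by rewrite sv.
Qed.

Lemma run_while_node v c s T1 T2 Q :
  is_node (s v) -> run c s T1 (fun s1 => run (While v c) s1 T2 Q) ->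
  run (While v c) s (T1 + T2).+1 Q.
Proof.
move=> nv [t1 [s1 [ex1 le1 [t2 [s2 [ex2 le2 Qs2]]]]]].
exists (t1 + t2).+1, s2; split=> //; first exact: ExecWhileNode ex2.
by rewrite ltnS leq_add.
Qed.

(* Only variable 0 is constrained initially, so that programs can be run one
   after the other, the variables from some bound on surviving each run. *)
Definition ptime A {eA : Enc A} B {eB : Enc B} (f : A -> B) : Prop :=
  exists c b T, [/\ writes_below b c, pbounded T
    & forall a s, s 0 = enc a -> run c s (T a) (fun s' => s' 0 = enc (f a))].
Arguments ptime {A eA B eB} f.

(** Only the encoded values matter, so a function may be replaced by one into another type whose
    values are the same trees. *)
Lemma ptime_recode E {eE : Enc E} B {eB : Enc B} C {eC : Enc C}
    (f : E -> B) (g : E -> C) :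
  (forall e, enc (g e) = enc (f e)) -> ptime f -> ptime g.
Proof.
move=> fg [c [b [T [wc bT ex]]]]; exists c, b, T; split=> // a s s0.
by rewrite fg; apply: ex.
Qed.

Lemma ptime_ext E {eE : Enc E} B {eB : Enc B} (f g : E -> B) :
  f =1 g -> ptime f -> ptime g.
Proof. by move=> fg; apply: ptime_recode => e; rewrite fg. Qed.

Lemma pbounded_ptime E {eE : Enc E} B {eB : Enc B} (f : E -> B) :
  ptime f -> pbounded (fun e => sz (f e)).
Proof.
move=> [c [b [T [_ bT ex]]]].
apply: (@pbounded_le _ _ _ (fun e => sz e + T e)) => [e|].
  have [t [s' [/exec_size le_s le_t s'0]]] := ex e (fun=> enc e) erefl.
  by have := le_s 0; rewrite s'0 /sz; lia.
by apply: pbounded_add => //; apply: pbounded_sz.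
Qed.

(** * Closure properties of polynomial-time functions *)

Lemma ptime_id E {eE : Enc E} : ptime (fun e : E => e).
Proof.
exists (Assign 0 (EVar 0)), 1, sz; split=> //; first exact: pbounded_sz.
by move=> a s s0; apply: run_assign => /=; rewrite s0.
Qed.

Lemma ptime_comp E {eE : Enc E} B {eB : Enc B} C {eC : Enc C}
    (f : E -> B) (g : B -> C) :
  ptime f -> ptime g -> ptime (fun e => g (f e)).
Proof.
move=> pf; have bf := pbounded_ptime pf.
case: pf => [c1 [b1 [T1 [w1 bT1 ex1]]]] [c2 [b2 [T2 [w2 bT2 ex2]]]].
exists (Seq c1 c2), (maxn b1 b2), (fun e => T1 e + T2 (f e)); split.
- by rewrite /= (writes_below_le _ w1) ?(writes_below_le _ w2) ?leq_maxl ?leq_maxr.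
- by apply: pbounded_add => //; apply: pbounded_comp.
move=> a s s0; apply: run_seq; apply: run_le (ex1 a s s0) (leqnn _) _ => s1 s10.
exact: ex2.
Qed.

Lemma ptime_leaf E {eE : Enc E} : ptime (fun _ : E => Leaf).
Proof.
exists (Assign 0 ELeaf), 1, (fun=> 1); split=> //; first exact: pbounded_const.
by move=> a s s0; apply: run_assign.
Qed.

(** Running [f] destroys the input, so the input is kept in the fresh variable [b], and the first
    result in [b.+1] while [g] runs. *)
Lemma ptime_node E {eE : Enc E} (f g : E -> tree) :
  ptime f -> ptime g -> ptime (fun e => Node (f e) (g e)).
Proof.
move=> pf pg; have := pbounded_ptime pf; have := pbounded_ptime pg.
case: pf pg => [c1 [b1 [T1 [w1 bT1 ex1]]]] [c2 [b2 [T2 [w2 bT2 ex2]]]] bg bf.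
pose b := maxn 1 (maxn b1 b2).
exists (Seq (Assign b (EVar 0)) (Seq c1 (Seq (Assign b.+1 (EVar 0))
  (Seq (Assign 0 (EVar b)) (Seq c2 (Assign 0 (ENode b.+1 0))))))), b.+2,
  (fun e : E => sz e + (T1 e + (sz (f e) + (sz e + (T2 e + (sz (f e) + sz (g e)).+1))))).
have w1b : writes_below b c1 by apply: writes_below_le w1; lia.
have w2b : writes_below b c2 by apply: writes_below_le w2; lia.
split.
- have [le1 le2] : b <= b.+2 /\ b < b.+2 by lia.
  by rewrite /= (writes_below_le le1 w1b) (writes_below_le le1 w2b) ltnS leqnSn ltnSn.
- by do ![apply: pbounded_add | apply: pbounded_S | assumption | apply: pbounded_sz].
move=> e s s0.
apply: run_seq; apply: run_assign; rewrite /= s0 //.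
have n0b : (0 == b) = false by lia.
have ub0 a s' : update s' b a 0 = s' 0 by rewrite /update n0b.
apply: run_seq; apply: run_le (run_frame w1b (ex1 e _ _)) (leqnn _) _.
  by rewrite ub0.
move=> s1 [s10 fr1]; apply: run_seq; apply: run_assign; rewrite /= s10 //.
apply: run_seq; apply: run_assign => /=.
  by rewrite /update ltn_eqF // fr1 // /update eqxx.
apply: run_seq; apply: run_le (run_frame w2b (ex2 e _ _)) (leqnn _) _.
  by rewrite /update /= ltn_eqF // fr1 // /update eqxx.
move=> s2 [s20 fr2]; apply: run_assign => /=.
  by rewrite s20 fr2 ?leqnSn // /update /= eqxx -addSn addSn.
by rewrite {1}/update /= s20 fr2 ?leqnSn // /update /= eqxx.
Qed.

Lemma ptime_pair E {eE : Enc E} B {eB : Enc B} C {eC : Enc C}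
    (f : E -> B) (g : E -> C) :
  ptime f -> ptime g -> ptime (fun e => (f e, g e)).
Proof.
move=> pf pg; 
  apply: (@ptime_recode _ _ _ _ _ _ (fun e => Node (enc (f e)) (enc (g e)))) => //.
by apply: ptime_node; [apply: ptime_recode pf | apply: ptime_recode pg].
Qed.

Lemma ptime_tree_const E {eE : Enc E} (a : tree) : ptime (fun _ : E => a).
Proof.
by elim: a => [|a IHa b IHb]; [apply: ptime_leaf | apply: ptime_node].
Qed.

Lemma ptime_const E {eE : Enc E} B {eB : Enc B} (x : B) : ptime (fun _ : E => x).
Proof. exact: ptime_recode (ptime_tree_const (enc x)). Qed.

Definition left_tree (a : tree) : tree := if a is Node b _ then b else Leaf.
Definition right_tree (a : tree) : tree := if a is Node _ b then b else Leaf.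

Lemma ptime_left : ptime left_tree.
Proof.
exists (Assign 0 (EHead 0)), 1, sz; split=> //; first exact: pbounded_sz.
move=> a s s0; apply: run_assign; rewrite /= s0; case: a {s0} => //= a b.
by rewrite /sz /=; lia.
Qed.

Lemma ptime_right : ptime right_tree.
Proof.
exists (Assign 0 (ETail 0)), 1, sz; split=> //; first exact: pbounded_sz.
move=> a s s0; apply: run_assign; rewrite /= s0; case: a {s0} => //= a b.
by rewrite /sz /=; lia.
Qed.

Lemma ptime_enc E {eE : Enc E} B {eB : Enc B} (f : E -> B) :
  ptime f -> ptime (fun e => enc (f e) : tree).
Proof. exact: ptime_recode. Qed.

Lemma ptime_fst E {eE : Enc E} B {eB : Enc B} C {eC : Enc C} (f : E -> B * C) :
  ptime f -> ptime (fun e => (f e).1).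
Proof. by move/ptime_enc/ptime_comp/(_ ptime_left); apply: ptime_recode. Qed.

Lemma ptime_snd E {eE : Enc E} B {eB : Enc B} C {eC : Enc C} (f : E -> B * C) :
  ptime f -> ptime (fun e => (f e).2).
Proof. by move/ptime_enc/ptime_comp/(_ ptime_right); apply: ptime_recode. Qed.

Lemma ptime_cons E {eE : Enc E} B {eB : Enc B} (f : E -> B) (g : E -> seq B) :
  ptime f -> ptime g -> ptime (fun e => f e :: g e).
Proof. by move=> pf /(ptime_pair pf); apply: ptime_recode. Qed.

Lemma ptime_behead E {eE : Enc E} B {eB : Enc B} (g : E -> seq B) :
  ptime g -> ptime (fun e => behead (g e)).
Proof.
by move/ptime_enc/ptime_comp/(_ ptime_right); apply: ptime_recode => e; case: (g e).
Qed.

Lemma ptime_succ E {eE : Enc E} (f : E -> nat) :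
  ptime f -> ptime (fun e => (f e).+1).
Proof.
by move/ptime_enc/(ptime_node (ptime_leaf)); apply: ptime_recode.
Qed.

Lemma ptime_pred E {eE : Enc E} (f : E -> nat) :
  ptime f -> ptime (fun e => (f e).-1).
Proof.
by move/ptime_enc/ptime_comp/(_ ptime_right); apply: ptime_recode => e; case: (f e).
Qed.

Lemma ptime_if_node E {eE : Enc E} B {eB : Enc B} (g : E -> tree) (f1 f2 : E -> B) :
  ptime g -> ptime f1 -> ptime f2 ->
  ptime (fun e => if is_node (g e) then f1 e else f2 e).
Proof.
move=> pg; have bg := pbounded_ptime pg; case: pg => [c [b0 [T [w bT ex]]]].
move=> [c1 [b1 [T1 [w1 bT1 ex1]]]] [c2 [b2 [T2 [w2 bT2 ex2]]]].
pose b := maxn (maxn 1 b0) (maxn b1 b2).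
exists (Seq (Assign b (EVar 0)) (Seq c (Seq (Assign b.+1 (EVar 0))
  (Seq (Assign 0 (EVar b)) (If b.+1 c1 c2))))), b.+2,
  (fun e : E => sz e + (T e + (sz (g e) + (sz e + (T1 e + T2 e).+1)))).
have wb : writes_below b c by apply: writes_below_le w; lia.
have w1b : writes_below b.+2 c1 by apply: writes_below_le w1; lia.
have w2b : writes_below b.+2 c2 by apply: writes_below_le w2; lia.
split.
- have [le1 le2] : b <= b.+2 /\ b < b.+2 by lia.
  by rewrite /= w1b w2b (writes_below_le le1 wb) ltnS leqnSn ltnSn.
- by do ![apply: pbounded_add | apply: pbounded_S | assumption | apply: pbounded_sz].
move=> e s s0.
have b_gt0 : 0 < b by lia.
apply: run_seq; apply: run_assign; rewrite /= s0 //.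
apply: run_seq; apply: run_le (run_frame wb (ex e _ _)) (leqnn _) _.
  by rewrite /update ltn_eqF.
move=> s1 [s10 fr1]; apply: run_seq; apply: run_assign; rewrite /= s10 //.
apply: run_seq; apply: run_assign => /=.
  by rewrite /update ltn_eqF // fr1 // /update eqxx.
apply: run_if.
rewrite {1}/update /= {1}/update eqxx; change (is_node (enc (g e))) with (is_node (g e)).
case: (is_node (g e)).
  refine (@run_le _ _ (T1 e) _ _ _ (ex1 e _ _) (leq_addr _ _) _) => //.
  by rewrite /update /= ltn_eqF // fr1 // /update eqxx.
refine (@run_le _ _ (T2 e) _ _ _ (ex2 e _ _) (leq_addl _ _) _) => //.
by rewrite /update /= ltn_eqF // fr1 // /update eqxx.
Qed.

Lemma ptime_if E {eE : Enc E} B {eB : Enc B} (g : E -> bool) (f1 f2 : E -> B) :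
  ptime g -> ptime f1 -> ptime f2 -> ptime (fun e => if g e then f1 e else f2 e).
Proof.
move=> /ptime_enc pg pf1 pf2; apply: ptime_ext (ptime_if_node pg pf1 pf2) => e.
by case: (g e).
Qed.

Lemma ptime_head E {eE : Enc E} B {eB : Enc B} (d : E -> B) (g : E -> seq B) :
  ptime d -> ptime g -> ptime (fun e => head (d e) (g e)).
Proof.
move=> /ptime_enc pd /ptime_enc pg.
have := ptime_if_node pg (ptime_comp pg ptime_left) pd.
by apply: ptime_recode => e; case: (g e).
Qed.

(* Variables b, b.+1 and b.+2 hold the environment, the rest of the list and the
   accumulator. *)
Lemma ptime_foldl E {eE : Enc E} A {eA : Enc A} S {eS : Enc S}
    (step : E -> S -> A -> S) (init : E -> S) (l : E -> seq A) (H : E -> nat) :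
  ptime (fun p : E * S * A => step p.1.1 p.1.2 p.2) -> ptime init -> ptime l ->
  pbounded H ->
  (forall e l1 l2, l e = l1 ++ l2 -> sz (foldl (step e) (init e) l1) <= H e) ->
  ptime (fun e => foldl (step e) (init e) (l e)).
Proof.
move=> [c [b0 [T [w bT ex]]]] pi pl bH leH.
have bl := pbounded_ptime pl; have bi := pbounded_ptime pi.
case: pi pl => [c1 [b1 [T1 [w1 bT1 ex1]]]] [c2 [b2 [T2 [w2 bT2 ex2]]]].
pose b := maxn (maxn 2 b0) (maxn b1 b2).
pose body := Seq (Assign 0 (ENode b b.+2)) (Seq (Assign 1 (EHead b.+1))
  (Seq (Assign 0 (ENode 0 1)) (Seq c (Seq (Assign b.+2 (EVar 0))
  (Assign b.+1 (ETail b.+1)))))).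
(* [R e] bounds every tree that an iteration stores outside the call of [c], and also the successor
   of the size of the triple passed to [c]; the call therefore costs at most [R e ^ k]. *)
pose R (e : E) := 2 * @sz E eE e + 2 * H e + 4 * @sz _ (@enc_seq A eA) (l e) + 3.
have [k leTk] := bT.
pose Tb (e : E) := R e + (R e + (R e + (R e ^ k + (R e + R e)))).

exists (Seq (Assign b (EVar 0)) (Seq c2 (Seq (Assign b.+1 (EVar 0))
  (Seq (Assign 0 (EVar b)) (Seq c1 (Seq (Assign b.+2 (EVar 0))
  (Seq (While b.+1 body) (Assign 0 (EVar b.+2))))))))), b.+3,
  (fun e => sz e + (T2 e + (sz (l e) + (sz e + (T1 e + (sz (init e) +
    ((sz (l e) * (Tb e).+1).+1 + H e))))))).
have wb : writes_below b c by apply: writes_below_le w; lia.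
have w1b : writes_below b c1 by apply: writes_below_le w1; lia.
have w2b : writes_below b c2 by apply: writes_below_le w2; lia.
have b1lt : 1 < b by lia.
have b_gt0 : 0 < b by lia.
have nb0 : (b == 0) = false by lia.
have nb1 : (b == 1) = false by lia.
have n0b : (0 == b) = false by lia.
have n1b : (1 == b) = false by lia.
have nSb : (b.+1 == b) = false by lia.
have nSSb : (b.+2 == b) = false by lia.
have nSSb1 : (b.+2 == b.+1) = false by lia.
have nb2 : (b == b.+2) = false by lia.
have nb12 : (b.+1 == b.+2) = false by lia.
have nb3 : (b == b.+1) = false by lia.
have bR : pbounded R.
  by rewrite /R; do ![apply: pbounded_add | apply: pbounded_mul | assumption
    | apply: pbounded_const | apply: pbounded_sz].
have bRk : pbounded (fun e => R e ^ k).
  case: bR => k' hk'; exists (k' * k) => e; rewrite expnM.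
  by case: (k) => // k''; rewrite leq_exp2r.
split.
- have le1 : b <= b.+3 by lia.
  rewrite /= (writes_below_le le1 wb) (writes_below_le le1 w1b).
  by rewrite (writes_below_le le1 w2b); lia.
- by rewrite /Tb; do ![assumption | apply: pbounded_add | apply: pbounded_S
    | apply: pbounded_mul | apply: pbounded_sz].
move=> e s s0.
(* Invariant: [l1] has been folded and [l2] remains. The cost is counted per node of [l2], and every
   iteration consumes some of them. *)
have loop l2 l1 s1 : l e = l1 ++ l2 ->
    s1 b = enc e -> s1 b.+1 = enc l2 -> s1 b.+2 = enc (foldl (step e) (init e) l1) ->
    run (While b.+1 body) s1 (sz l2 * (Tb e).+1).+1
      (fun s' => s' b.+2 = enc (foldl (step e) (init e) (l e))).
  elim: l2 l1 s1 => [|x l2 IHl] l1 s1 def_l s1b s1b1 s1b2.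
    by apply: run_while_leaf; rewrite // s1b2 def_l cats0.
  have szl : sz x + sz l2 < sz (l e).
    rewrite def_l; elim: (l1) => [|y l3 IHl3]; first by rewrite cat0s sz_cons ltnS.
    by rewrite cat_cons sz_cons; lia.
  (* Without a bound on all prefixes the accumulator could double in every iteration, even for a
     polynomial-time step. *)
  have leH1 : sz (foldl (step e) (init e) l1) <= H e := leH e l1 _ def_l.
  have leH2 : sz (step e (foldl (step e) (init e) l1) x) <= H e.
    have := leH e (rcons l1 x) l2; rewrite -cats1 -catA => /(_ def_l).
    by rewrite foldl_cat.
  set acc := foldl (step e) (init e) l1 in s1b2 leH1 leH2.
  refine (@run_le _ _ (Tb e + (sz l2 * (Tb e).+1).+1).+1 _ _ _ _ _ (fun _ h => h));
    last first.
    by rewrite sz_cons; have := sz_gt0 x; nia.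
  apply: run_while_node; first by rewrite s1b1.
  rewrite /body /Tb.
  have xsz : tree_size (enc x) = sz x by [].
  have esz : tree_size (enc e) = sz e by [].
  have asz : tree_size (enc acc) = sz acc by [].
  have lsz : tree_size (enc l2) = sz l2 by [].
  apply: run_seq; apply: run_assign; rewrite /= s1b s1b2 /=.
    by rewrite esz asz /R; lia.
  apply: run_seq; apply: run_assign; rewrite /= /update /= s1b1 /=.
    by rewrite xsz /R; lia.
  apply: run_seq; apply: run_assign => /=.
    by rewrite esz asz xsz /R; lia.
  apply: run_seq; apply: run_le (run_frame wb (ex (e, acc, x) _ _)) _ _.
  - by [].
  - apply: leq_trans (leTk _) _; case: (k) => // k'; rewrite leq_exp2r //.
    by rewrite !sz_pair /= /R; lia.
  move=> s2 [s20 fr]; apply: run_seq; apply: run_assign; rewrite /= s20 /=.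
    by rewrite -/(sz _) /R; lia.
  apply: run_assign; rewrite /= /update nb12 fr //= /update /= eqSS nb0.
    by rewrite s1b1 /= lsz /R; lia.
  apply: (IHl (rcons l1 x)).
  - by rewrite -cats1 -catA.
  - by rewrite nb3 nb2 fr // /update nb0 nb1.
  - by rewrite eqxx s1b1.
  - by rewrite nSSb1 eqxx -cats1 foldl_cat.
apply: run_seq; apply: run_assign; rewrite /= s0 //.
apply: run_seq; apply: run_le (run_frame w2b (ex2 e _ _)) (leqnn _) _.
  by rewrite /update n0b.
move=> s1 [s10 fr1]; apply: run_seq; apply: run_assign; rewrite /= s10 //.
have s1b : s1 b = enc e by rewrite fr1 // /update eqxx.
have s1b' : update s1 b.+1 (enc (l e)) b = enc e by rewrite /update nb3.
apply: run_seq; apply: run_assign; rewrite /= s1b' //.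
apply: run_seq; apply: run_le (run_frame w1b (ex1 e _ _)) (leqnn _) _.
  by rewrite /update.
move=> s2 [s20 fr2]; apply: run_seq; apply: run_assign; rewrite /= s20 //.
apply: run_seq; apply: run_le (loop (l e) [::] _ _ _ _ _) (leqnn _) _ => //.
- by rewrite /update nb2 fr2 // /update nb0 nb3.
- by rewrite /update nb12 fr2 ?leqnSn // /update /= eqxx.
- by rewrite /update eqxx.
move=> s3 s3b2; apply: run_assign; rewrite /= s3b2 //.
by apply: (leH e (l e) [::]); rewrite cats0.
Qed.

Lemma sz_cat A {eA : Enc A} (l1 l2 : seq A) : sz (l1 ++ l2) = (sz l1 + sz l2).-1.
Proof.
elim: l1 => [|x l1 IHl]; first by rewrite cat0s.
rewrite cat_cons !sz_cons IHl; have l1_gt0 : 0 < sz l1 by exact: sz_gt0.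
  have l2_gt0 : 0 < sz l2 by exact: sz_gt0.
  lia.
Qed.

Lemma sz_catl A {eA : Enc A} (l1 l2 : seq A) : sz l1 <= sz (l1 ++ l2).
Proof.
rewrite sz_cat; have l2_gt0 : 0 < sz l2 by exact: sz_gt0.
  lia. Qed.

Lemma sz_catr A {eA : Enc A} (l1 l2 : seq A) : sz l2 <= sz (l1 ++ l2).
Proof. rewrite sz_cat; have l1_gt0 : 0 < sz l1 by exact: sz_gt0.
  lia. Qed.

Lemma sz_rev A {eA : Enc A} (l : seq A) : sz (rev l) = sz l.
Proof.
elim: l => // x l IHl; rewrite rev_cons -cats1 sz_cat IHl !sz_cons.
have -> : sz ([::] : seq A) = 1 by []; have l_gt0 : 0 < sz l by exact: sz_gt0.
  lia.
Qed.

Lemma sz_seq_le A {eA : Enc A} K (l : seq A) :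
  all (fun x => sz x <= K) l -> sz l <= (size l * K.+1).+1.
Proof.
by elim: l => // x l IHl /= /andP[lex /IHl]; rewrite sz_cons; lia.
Qed.

Section Library.
Context (E : Type) {eE : Enc E}.

Lemma ptime_rev A {eA : Enc A} (l : E -> seq A) :
  ptime l -> ptime (fun e => rev (l e)).
Proof.
move=> pl.
have revE (s : seq A) : rev s = foldl (fun z x => x :: z) [::] s.
  by rewrite -[s in RHS]revK foldl_rev; elim: (rev s) => //= x z <-.
apply: (ptime_ext (fun e => esym (revE (l e)))).
apply: (@ptime_foldl _ _ _ _ _ _ (fun _ z x => x :: z) _ _ (fun e => sz (l e))) => //.
- by apply: ptime_cons; [apply: ptime_snd | apply: ptime_snd; apply: ptime_fst];
    apply: ptime_id.
- exact: ptime_const.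
- exact: pbounded_ptime.
by move=> e l1 l2 ->; rewrite -revE sz_rev sz_catl.
Qed.

(** This is a left fold over the reversed list, so the size bound is now required on suffixes. *)
Lemma ptime_foldr A {eA : Enc A} S {eS : Enc S}
    (step : E -> A -> S -> S) (init : E -> S) (l : E -> seq A) (H : E -> nat) :
  ptime (fun p : E * A * S => step p.1.1 p.1.2 p.2) -> ptime init -> ptime l ->
  pbounded H ->
  (forall e l1 l2, l e = l1 ++ l2 -> sz (foldr (step e) (init e) l2) <= H e) ->
  ptime (fun e => foldr (step e) (init e) (l e)).
Proof.
move=> ps pi pl bH leH.
apply: (@ptime_ext _ _ _ _ (fun e => foldl (fun z x => step e x z) (init e) (rev (l e)))).
  by move=> e; rewrite foldl_rev.
apply: (ptime_foldl (H := H)) => //; last first.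
- move=> e l1 l2 def_l; rewrite -[l1]revK foldl_rev; apply: leH (rev l2) _ _.
  by rewrite -rev_cat -def_l revK.
- exact: ptime_rev.
apply: (ptime_comp (f := fun p : E * S * A => (p.1.1, p.2, p.1.2)) _ ps).
apply: ptime_pair; last by apply: ptime_snd; apply: ptime_fst; apply: ptime_id.
apply: ptime_pair; last by apply: ptime_snd; apply: ptime_id.
by do 2!apply: ptime_fst; apply: ptime_id.
Qed.

Lemma pbounded_exp k (h : E -> nat) : pbounded h -> pbounded (fun e => h e ^ k).
Proof.
case=> l hl; exists (l * k) => e; rewrite expnM.
by case: k => // k; rewrite leq_exp2r.
Qed.

Lemma ptime_map A {eA : Enc A} B {eB : Enc B} (F : E -> A -> B) (l : E -> seq A) :
  ptime (fun p : E * A => F p.1 p.2) -> ptime l ->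
  ptime (fun e => map (F e) (l e)).
Proof.
move=> pF pl; have [k hk] := pbounded_ptime pF; have bl := pbounded_ptime pl.
(* No entry is larger than the list, so [(sz e + sz (l e)).+2 ^ k] bounds the size of each image,
   and there are fewer than [sz (l e)] images. *)
have bH : pbounded (fun e => sz (l e) * ((sz e + sz (l e)).+2 ^ k).+1 + 1).
  apply: pbounded_add; last exact: pbounded_const.
  apply: pbounded_mul => //; apply: pbounded_S; apply: pbounded_exp.
  by do 2!apply: pbounded_S; apply: pbounded_add => //; apply: pbounded_sz.
apply: (@ptime_ext _ _ _ _ (fun e => foldr (fun x z => F e x :: z) [::] (l e))) => //.
apply: (@ptime_foldr _ _ _ _ (fun e x z => F e x :: z) _ _ _ _ _ _ bH) => //.
- apply: ptime_cons; last by apply: ptime_snd; apply: ptime_id.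
  apply: (ptime_comp (f := fun p : E * A * seq B => p.1) _ pF).
  by apply: ptime_fst; apply: ptime_id.
- exact: ptime_const.
move=> e l1 l2 def_l; have : sz l2 <= sz (l e) by rewrite def_l sz_catr.
rewrite addn1; elim: l2 {def_l} => // x l2 IHl le_l; move: (le_l).
rewrite sz_cons => le_xl /=; rewrite sz_cons.
rewrite -[foldr _ _ _]/(map (F e) l2).
have leF : sz (F e x) <= (sz e + sz (l e)).+2 ^ k.
  apply: leq_trans (hk (e, x)) _; case: (k) => // k'; rewrite leq_exp2r // sz_pair /=.
  by lia.
have : sz (map (F e) l2) <= (sz l2 * ((sz e + sz (l e)).+2 ^ k).+1).+1.
  have : sz l2 <= sz (l e) by lia.
  elim: (l2) => // y l3 IH; rewrite map_cons !sz_cons => le3.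
  have leFy : sz (F e y) <= (sz e + sz (l e)).+2 ^ k.
    apply: leq_trans (hk (e, y)) _; case: (k) => // k'; rewrite leq_exp2r // sz_pair /=.
    by lia.
  have y_gt0 : 0 < sz y by exact: sz_gt0.
  by have /IH : sz l3 <= sz (l e); [lia | nia].
have x_gt0 : 0 < sz x by exact: sz_gt0.
by nia.
Qed.
End Library.

Lemma iota0S k : iota 0 k.+1 = rcons (iota 0 k) k.
Proof. by rewrite -addn1 iotaD cats1. Qed.

Section Arithmetic.
Context (E : Type) {eE : Enc E}.
Implicit Types (b c : E -> bool) (m n : E -> nat).

(** A unary number and a list of that many leaves are the same tree, so iteration is a fold over
    such a list. *)
Lemma ptime_nseq n : ptime n -> ptime (fun e => nseq (n e) Leaf).
Proof.
by apply: ptime_recode => e; elim: (n e) => // k IHk; exact: (congr1 (Node Leaf) IHk).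
Qed.

Lemma ptime_iter S {eS : Enc S} (step : E -> S -> S) (init : E -> S) n (H : E -> nat) :
  ptime (fun p : E * S => step p.1 p.2) -> ptime init -> ptime n -> pbounded H ->
  (forall e i, i <= n e -> sz (iter i (step e) (init e)) <= H e) ->
  ptime (fun e => iter (n e) (step e) (init e)).
Proof.
move=> ps pi pn bH leH.
have iterE e i : foldr (fun (_ : tree) s => step e s) (init e) (nseq i Leaf)
    = iter i (step e) (init e).
  by elim: i => //= i ->.
apply: (ptime_ext (fun e => iterE e (n e))).
apply: (ptime_foldr (step := fun e (_ : tree) s => step e s) (H := H)) => //.
- apply: (ptime_comp (f := fun p : E * tree * S => (p.1.1, p.2)) _ ps).
  apply: ptime_pair; last by apply: ptime_snd; apply: ptime_id.
  by do 2!apply: ptime_fst; apply: ptime_id.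
- exact: ptime_nseq.
move=> e l1 l2 def_l.
have -> : l2 = nseq (n e - size l1) Leaf by rewrite -drop_nseq def_l drop_size_cat.
by rewrite iterE leH ?leq_subr.
Qed.

Lemma ptime_negb b : ptime b -> ptime (fun e => ~~ b e).
Proof. by move=> pb; apply: (ptime_if pb); apply: ptime_const. Qed.

Lemma ptime_andb b c : ptime b -> ptime c -> ptime (fun e => b e && c e).
Proof. by move=> pb pc; apply: (ptime_if pb pc); apply: ptime_const. Qed.

Lemma ptime_orb b c : ptime b -> ptime c -> ptime (fun e => b e || c e).
Proof. by move=> pb; apply: ptime_if pb _; apply: ptime_const. Qed.

Lemma ptime_eqb b c : ptime b -> ptime c -> ptime (fun e => b e == c e).
Proof.
move=> pb pc; apply: (@ptime_ext _ _ _ _ (fun e => if b e then c e else ~~ c e)).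
  by move=> e; case: (b e) (c e) => [] [].
by apply: ptime_if => //; apply: ptime_negb.
Qed.

Lemma ptime_addb b c : ptime b -> ptime c -> ptime (fun e => b e (+) c e).
Proof. move=> pb pc; apply: ptime_ext (ptime_if pb (ptime_negb pc) pc) => e.
by case: (b e). Qed.

Lemma ptime_add m n : ptime m -> ptime n -> ptime (fun e => m e + n e).
Proof.
move=> pm pn; apply: (@ptime_ext _ _ _ _ (fun e => iter (m e) succn (n e))).
  by move=> e; rewrite iter_succn addnC.
have bH : pbounded (fun e => sz (m e) + sz (n e)).
  by apply: pbounded_add; apply: pbounded_ptime.
apply: (ptime_iter (step := fun=> succn) _ pn pm bH).
  by apply: ptime_succ; apply: ptime_snd; apply: ptime_id.
by move=> e i le_i; rewrite iter_succn !sz_nat; lia.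
Qed.

Lemma ptime_sub m n : ptime m -> ptime n -> ptime (fun e => m e - n e).
Proof.
move=> pm pn; apply: (@ptime_ext _ _ _ _ (fun e => iter (n e) predn (m e))).
  by move=> e; rewrite iter_predn.
apply: (ptime_iter (step := fun=> predn) _ pm pn (pbounded_ptime pm)).
  by apply: ptime_pred; apply: ptime_snd; apply: ptime_id.
by move=> e i le_i; rewrite iter_predn !sz_nat; lia.
Qed.

Lemma ptime_leq m n : ptime m -> ptime n -> ptime (fun e => m e <= n e).
Proof.
move=> pm pn; have /ptime_enc pmn := ptime_sub pm pn.
apply: ptime_ext (ptime_if_node pmn (ptime_const false) (ptime_const true)) => e.
by rewrite /leq; case: (m e - n e).
Qed.

Lemma ptime_eqn m n : ptime m -> ptime n -> ptime (fun e => m e == n e).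
Proof.
move=> pm pn; apply: (@ptime_ext _ _ _ _ (fun e => (m e <= n e) && (n e <= m e))).
  by move=> e; rewrite eqn_leq.
by apply: ptime_andb; apply: ptime_leq.
Qed.

Lemma ptime_drop A {eA : Enc A} n (l : E -> seq A) :
  ptime n -> ptime l -> ptime (fun e => drop (n e) (l e)).
Proof.
move=> pn pl; have dropE k (s : seq A) : iter k behead s = drop k s.
  elim: k s => [|k IHk] s; first by rewrite drop0.
  by rewrite iterS IHk -drop1 drop_drop add1n.
apply: (ptime_ext (fun e => dropE (n e) (l e))).
apply: (ptime_iter (step := fun=> behead) _ pl pn (pbounded_ptime pl)).
  by apply: ptime_behead; apply: ptime_snd; apply: ptime_id.
by move=> e i _; rewrite dropE -{2}(cat_take_drop i (l e)) sz_catr.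
Qed.

Lemma ptime_nth A {eA : Enc A} (d : E -> A) (l : E -> seq A) n :
  ptime d -> ptime l -> ptime n -> ptime (fun e => nth (d e) (l e) (n e)).
Proof.
move=> pd pl pn; apply: (ptime_ext _ (ptime_head pd (ptime_drop pn pl))) => e.
by rewrite -nth0 nth_drop addn0.
Qed.

Lemma ptime_size A {eA : Enc A} (l : E -> seq A) :
  ptime l -> ptime (fun e => size (l e)).
Proof.
move/(ptime_map (F := fun _ _ => Leaf) (ptime_const _)).
by apply: ptime_recode => e; elim: (l e) => // x s IHs; exact: (congr1 (Node Leaf) IHs).
Qed.

End Arithmetic.

Section Sequences.
Context (E : Type) {eE : Enc E}.
Implicit Types (m n : E -> nat).

Lemma ptime_mul m n : ptime m -> ptime n -> ptime (fun e => m e * n e).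
Proof.
move=> pm pn; apply: (@ptime_ext _ _ _ _ (fun e => iter (m e) (addn (n e)) 0)).
  by move=> e; rewrite iter_addn_0 mulnC.
have bH : pbounded (fun e => sz (m e) * sz (n e) + 1).
  apply: pbounded_add; last exact: pbounded_const.
  by apply: pbounded_mul; apply: pbounded_ptime.
apply: (ptime_iter (step := fun e => addn (n e)) _ _ pm bH).
- apply: ptime_add; last by apply: ptime_snd; apply: ptime_id.
  by apply: (ptime_comp _ pn); apply: ptime_fst; apply: ptime_id.
- exact: ptime_const.
by move=> e i le_i; rewrite iter_addn_0 !sz_nat; nia.
Qed.

Lemma ptime_iota m n : ptime m -> ptime n -> ptime (fun e => iota (m e) (n e)).
Proof.
move=> pm pn.
(* The length of the list built so far is its next entry, so no separate counter is carried
   along. *)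
pose step (s : seq nat) := (size s) :: s.
have stepE k : iter k step [::] = rev (iota 0 k).
  elim: k => // k IHk; rewrite iterS IHk /step size_rev size_iota.
  by rewrite iota0S rev_rcons.
have p0 : ptime (fun e => rev (iter (n e) step [::])).
  apply: ptime_rev.
  have bH : pbounded (fun e => sz (n e) * (sz (n e)).+1 + 1).
    apply: pbounded_add; last exact: pbounded_const.
    by apply: pbounded_mul; last apply: pbounded_S; apply: pbounded_ptime.
  apply: (ptime_iter (step := fun=> step) _ (ptime_const _) pn bH).
    apply: ptime_cons; last by apply: ptime_snd; apply: ptime_id.
    by apply: ptime_size; apply: ptime_snd; apply: ptime_id.
  move=> e i le_i; rewrite stepE sz_rev addn1.
  apply: leq_trans (@sz_seq_le _ _ (sz (n e)) _ _) _.
    by apply/allP => x; rewrite mem_iota !sz_nat; lia.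
  by rewrite size_iota ltnS leq_mul // sz_nat; lia.
apply: (@ptime_ext _ _ _ _ (fun e => [seq m e + i | i <- rev (iter (n e) step [::])])).
  by move=> e; rewrite stepE revK -iotaDl addn0.
apply: ptime_map => //; apply: ptime_add; last by apply: ptime_snd; apply: ptime_id.
by apply: (ptime_comp _ pm); apply: ptime_fst; apply: ptime_id.
Qed.

Lemma ptime_all A {eA : Enc A} (p : E -> A -> bool) (l : E -> seq A) :
  ptime (fun q : E * A => p q.1 q.2) -> ptime l -> ptime (fun e => all (p e) (l e)).
Proof.
move=> pp pl; apply: (@ptime_ext _ _ _ _
  (fun e => foldr (fun x z => p e x && z) true (l e))) => //.
apply: (@ptime_foldr _ _ _ _ _ _ (fun e x z => p e x && z) _ _ (fun=> 3)) => //.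
- apply: ptime_andb; last by apply: ptime_snd; apply: ptime_id.
  by apply: (ptime_comp _ pp); apply: ptime_fst; apply: ptime_id.
- exact: ptime_const.
- exact: pbounded_const.
by move=> *; apply: sz_bool.
Qed.

Lemma ptime_count A {eA : Enc A} (p : E -> A -> bool) (l : E -> seq A) :
  ptime (fun q : E * A => p q.1 q.2) -> ptime l ->
  ptime (fun e => count (p e) (l e)).
Proof.
move=> pp pl; have cE e s : count (p e) s =
    foldr (fun x z => if p e x then z.+1 else z) 0 s.
  by elim: s => //= x s <-; case: (p e x).
apply: (ptime_ext (fun e => esym (cE e (l e)))).
have bH : pbounded (fun e => (sz (l e)).*2.+1).
  apply: pbounded_S; apply: (pbounded_le (h2 := fun e => sz (l e) + sz (l e))).
    by move=> e; rewrite addnn.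
  by apply: pbounded_add; apply: pbounded_ptime.
apply: (@ptime_foldr _ _ _ _ _ _ (fun e x z => if p e x then z.+1 else z)
  _ _ _ _ _ _ bH) => //.
- apply: ptime_if; last by apply: ptime_snd; apply: ptime_id.
    by apply: (ptime_comp _ pp); apply: ptime_fst; apply: ptime_id.
  by apply: ptime_succ; apply: ptime_snd; apply: ptime_id.
- exact: ptime_const.
move=> e l1 l2 def_l; rewrite -cE sz_nat ltnS leq_double.
apply: leq_trans (count_size _ _) _; apply: leq_trans (ltnW (size_sz _)) _.
by rewrite def_l sz_catr.
Qed.

Lemma ptime_find A {eA : Enc A} (p : E -> A -> bool) (l : E -> seq A) :
  ptime (fun q : E * A => p q.1 q.2) -> ptime l ->
  ptime (fun e => find (p e) (l e)).
Proof.
move=> pp pl; have cE e s : find (p e) s =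
    foldr (fun x z => if p e x then 0 else z.+1) 0 s.
  by elim: s => //= x s <-; case: (p e x).
apply: (ptime_ext (fun e => esym (cE e (l e)))).
have bH : pbounded (fun e => (sz (l e)).*2.+1).
  apply: pbounded_S; apply: (pbounded_le (h2 := fun e => sz (l e) + sz (l e))).
    by move=> e; rewrite addnn.
  by apply: pbounded_add; apply: pbounded_ptime.
apply: (@ptime_foldr _ _ _ _ _ _ (fun e x z => if p e x then 0 else z.+1)
  _ _ _ _ _ _ bH) => //.
- apply: ptime_if; last by apply: ptime_succ; apply: ptime_snd; apply: ptime_id.
    by apply: (ptime_comp _ pp); apply: ptime_fst; apply: ptime_id.
  exact: ptime_const.
- exact: ptime_const.
move=> e l1 l2 def_l; rewrite -cE sz_nat ltnS leq_double.
apply: leq_trans (find_size _ _) _; apply: leq_trans (ltnW (size_sz _)) _.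
by rewrite def_l sz_catr.
Qed.

End Sequences.

(* Extended below, whenever a new function has been shown to be computable. *)
Ltac ptime_defined := fail.

(** The shape of the body selects the closure lemma. Constant functions are caught before any
    decomposition, so the operations inside them need no lemma. *)
Ltac ptime_step :=
  cbv beta;
  lazymatch goal with
  | |- ptime (fun e => e) => apply ptime_id
  | |- ptime fst => apply (ptime_fst ptime_id)
  | |- ptime snd => apply (ptime_snd ptime_id)
  | |- ptime (fun _ => ?x) => apply ptime_const
  | _ => first [ptime_builtin | ptime_hyp]
  end
with ptime_builtin :=
  first
  [ assumption
  | lazymatch goal with
    | |- ptime (fun e => fst (@?f e)) => apply (@ptime_fst _ _ _ _ _ _ f)
    | |- ptime (fun e => snd (@?f e)) => apply (@ptime_snd _ _ _ _ _ _ f)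
    | |- ptime (fun e => pair (@?f e) (@?g e)) => apply (@ptime_pair _ _ _ _ _ _ f g)
    | |- ptime (fun e => cons (@?f e) (@?g e)) => apply (@ptime_cons _ _ _ _ f g)
    | |- ptime (fun e => S (@?f e)) => apply (@ptime_succ _ _ f)
    | |- ptime (fun e => if _ then _ else _) => apply ptime_if
    | |- ptime (fun e => negb (@?b e)) => apply (@ptime_negb _ _ b)
    | |- ptime (fun e => andb (@?b e) (@?c e)) => apply (@ptime_andb _ _ b c)
    | |- ptime (fun e => orb (@?b e) (@?c e)) => apply (@ptime_orb _ _ b c)
    | |- ptime (fun e => addb (@?b e) (@?c e)) => apply (@ptime_addb _ _ b c)
    | |- ptime (fun e => eq_op (@?b e) (@?c e)) =>
        first [apply (@ptime_eqb _ _ b c) | apply (@ptime_eqn _ _ b c)]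
    | |- ptime (fun e => leq (@?m e) (@?n e)) => apply (@ptime_leq _ _ m n)
    | |- ptime (fun e => addn (@?m e) (@?n e)) => apply (@ptime_add _ _ m n)
    | |- ptime (fun e => subn (@?m e) (@?n e)) => apply (@ptime_sub _ _ m n)
    | |- ptime (fun e => muln (@?m e) (@?n e)) => apply (@ptime_mul _ _ m n)
    | |- ptime (fun e => iota (@?m e) (@?n e)) => apply (@ptime_iota _ _ m n)
    | |- ptime (fun e => size (@?l e)) => apply (@ptime_size _ _ _ _ l)
    | |- ptime (fun e => nth (@?d e) (@?l e) (@?n e)) =>
        apply (@ptime_nth _ _ _ _ d l n)
    | |- ptime (fun e => map (@?F e) (@?l e)) => apply (@ptime_map _ _ _ _ _ _ F l)
    | |- ptime (fun e => all (@?F e) (@?l e)) => apply (@ptime_all _ _ _ _ F l)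
    | |- ptime (fun e => count (@?F e) (@?l e)) => apply (@ptime_count _ _ _ _ F l)
    | |- ptime (fun e => find (@?F e) (@?l e)) => apply (@ptime_find _ _ _ _ F l)
    end
  | ptime_defined ]
with ptime_hyp :=
  match goal with
  | H : ptime ?x |- _ =>
    match goal with
    | |- ptime (fun e => x (@?f e)) => apply (fun pf => @ptime_comp _ _ _ _ _ _ f x pf H)
    end
  | H : ptime (fun p => ?F p.1 p.2) |- _ =>
    match goal with
    | |- ptime (fun e => F (@?f e) (@?g e)) =>
        apply (fun pf => @ptime_comp _ _ _ _ _ _ (fun e => (f e, g e)) _ pf H)
    end
  end.

Ltac ptime_tac := repeat ptime_step.

(** * Binary arithmetic *)

Notation bits := (seq bool) (only parsing).

Fixpoint value (s : bits) : nat := if s is b :: s' then b + (value s').*2 else 0.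

(** The default makes a list stand for an expansion padded with zeros, so operands may have
    different lengths. *)
Definition bit (s : bits) j := nth false s j.

(** The carry into position [u]: two equal bits determine the outgoing carry, two different bits
    pass the incoming one on. *)
Definition carry (x y : bits) u :=
  foldl (fun c j => if bit x j == bit y j then bit x j else c) false (iota 0 u).

(** Working modulo 2 ^ u bounds the size of the accumulator in all the folds built on this
    addition. *)
Definition add_bits u (x y : bits) : bits :=
  [seq bit x j (+) bit y j (+) carry x y j | j <- iota 0 u].

Definition mul_bits u (x y : bits) : bits :=
  foldr (fun (b : bool) z => add_bits u (if b then x else [::]) (false :: z)) [::] y.

(** The scan starts at the least significant bit, so the last position where the operands differ
    decides. *)
Definition le_bits (x y : bits) :=
  foldl (fun r j => if bit x j == bit y j then r else bit y j) true
    (iota 0 (size x + size y)).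

Definition pow_bits u k : bits := [seq j == k | j <- iota 0 u].

Definition digit_bits L a (s : bits) : bits :=
  [seq bit s (a * L + j) | j <- iota 0 L].

Definition sum_bits u A (l : seq A) (F : A -> bits) : bits :=
  foldr (fun x z => add_bits u (F x) z) [::] l.

Definition prod_bits u A (l : seq A) (F : A -> bits) : bits :=
  foldr (fun x z => mul_bits u (F x) z) [:: true] l.

(** Fixed-width results must be normalised, since the output format excludes leading zeros, which
    are trailing entries here. *)
Definition trim (s : bits) : bits :=
  foldr (fun (b : bool) z => if b then b :: z
    else if size z == 0 then [::] else b :: z) [::] s.

Lemma value_cat s t : value (s ++ t) = value s + 2 ^ size s * value t.
Proof.
elim: s => [|b s IHs] /=; first by rewrite mul1n.
by rewrite IHs expnS doubleD addnA -[(_ * _).*2]mul2n mulnA.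
Qed.

Lemma value_rcons s b : value (rcons s b) = value s + 2 ^ size s * b.
Proof. by rewrite -cats1 value_cat /= double0 addn0. Qed.

Lemma value_lt s : value s < 2 ^ size s.
Proof. by elim: s => //= b s IHs; rewrite expnS; lia. Qed.

Lemma value_mod s u : value s %% 2 ^ u = value (take u s).
Proof.
have [le_us|lt_su] := leqP u (size s).
  rewrite -{1}(cat_take_drop u s) value_cat size_take_min (minn_idPl le_us).
  rewrite addnC mulnC modnMDl modn_small //.
  by rewrite -{2}(minn_idPl le_us) -size_take_min value_lt.
rewrite take_oversize 1?ltnW // modn_small //.
by apply: leq_trans (value_lt s) _; rewrite leq_exp2l // ltnW.
Qed.

Lemma value_modS s u : value s %% 2 ^ u.+1 = value s %% 2 ^ u + 2 ^ u * bit s u.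
Proof.
rewrite !value_mod /bit; have [lt_us|le_su] := ltnP u (size s).
  by rewrite (take_nth false) // value_rcons size_takel // ltnW.
by rewrite nth_default // muln0 addn0 !take_oversize // (leq_trans le_su).
Qed.

Lemma value_map_iota (F : nat -> bool) u :
  value [seq F j | j <- iota 0 u.+1] = value [seq F j | j <- iota 0 u] + 2 ^ u * F u.
Proof. by rewrite iota0S map_rcons value_rcons size_map size_iota. Qed.

Lemma value_map_bit s u : value [seq bit s j | j <- iota 0 u] = value s %% 2 ^ u.
Proof.
elim: u => [|u IHu]; first by rewrite modn1.
by rewrite value_map_iota IHu value_modS.
Qed.

Lemma carryS x y u : carry x y u.+1 = if bit x u == bit y u then bit x u else carry x y u.
Proof. by rewrite /carry iota0S -cats1 foldl_cat. Qed.

(** The invariant of the adder: the carry is precisely what overflows the first [u] positions. *)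
Lemma value_add_carry u x y : value (add_bits u x y) + 2 ^ u * carry x y u =
  value x %% 2 ^ u + value y %% 2 ^ u.
Proof.
elim: u => [|u IHu]; first by rewrite !modn1.
rewrite /add_bits value_map_iota !value_modS carryS expnS.
move: IHu; rewrite /add_bits; move: (value [seq _ | _ <- _]) => v.
move: (2 ^ u) (carry x y u) (bit x u) (bit y u) => p [] [] [] /=; lia.
Qed.

Lemma value_add u x y : value (add_bits u x y) = (value x + value y) %% 2 ^ u.
Proof.
rewrite -modnDm -value_add_carry addnC mulnC modnMDl modn_small //.
by have := value_lt (add_bits u x y); rewrite size_map size_iota.
Qed.

Lemma value_mul u x y : value (mul_bits u x y) = (value x * value y) %% 2 ^ u.
Proof.
elim: y => [|b y IHy]; first by rewrite muln0 mod0n.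
rewrite [mul_bits _ _ _]/= value_add /= add0n IHy -!muln2.
rewrite -modnDmr modnMml modnDmr mulnDr mulnA; congr ((_ + _) %% _).
by case: (b); rewrite /= ?muln1 ?muln0.
Qed.

Lemma value_sum u A (l : seq A) F :
  value (sum_bits u l F) = (\sum_(x <- l) value (F x)) %% 2 ^ u.
Proof.
elim: l => [|x l IHl]; first by rewrite big_nil mod0n.
by rewrite /= value_add IHl big_cons modnDmr.
Qed.

Lemma value_prod u A (l : seq A) F : 0 < u ->
  value (prod_bits u l F) = (\prod_(x <- l) value (F x)) %% 2 ^ u.
Proof.
move=> u_gt0; elim: l => [|x l IHl].
  by rewrite big_nil modn_small // -{1}(expn0 2) ltn_exp2l.
by rewrite /= value_mul big_cons IHl modnMmr.
Qed.

Lemma value_pow u k : value (pow_bits u k) = if k < u then 2 ^ k else 0.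
Proof.
elim: u => // u IHu; rewrite /pow_bits value_map_iota -/(pow_bits u k) IHu ltnS.
by case: (ltngtP k u) => [_|_|->]; rewrite ?muln0 ?muln1 ?addn0.
Qed.

Lemma value_digit L a s :
  value (digit_bits L a s) = (value s %/ 2 ^ (a * L)) %% 2 ^ L.
Proof.
have -> : digit_bits L a s = [seq bit (drop (a * L) s) j | j <- iota 0 L].
  by apply: eq_map => j; rewrite /bit nth_drop.
rewrite value_map_bit; congr (_ %% _); set o := a * L.
have [le_os|lt_so] := leqP o (size s).
  rewrite -{2}(cat_take_drop o s) value_cat size_takel // addnC mulnC divnMDl ?expn_gt0 //.
  by rewrite divn_small ?addn0 // -value_mod ltn_mod expn_gt0.
rewrite drop_oversize 1?ltnW // divn_small //.
by apply: leq_trans (value_lt s) _; rewrite leq_exp2l // ltnW.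
Qed.

Lemma le_bitsP x y : le_bits x y = (value x <= value y).
Proof.
have inv k : foldl (fun r j => if bit x j == bit y j then r else bit y j) true (iota 0 k)
    = (value x %% 2 ^ k <= value y %% 2 ^ k).
  elim: k => [|k IHk]; first by rewrite !modn1.
  rewrite iota0S -cats1 foldl_cat IHk /= !value_modS.
  have := ltn_pmod (value x) (expn_gt0 2 k); have := ltn_pmod (value y) (expn_gt0 2 k).
  by case: (bit x k) (bit y k) => [] [] /=; lia.
rewrite /le_bits inv !modn_small //; apply: leq_trans (value_lt _) _;
  by rewrite leq_exp2l // ?leq_addl ?leq_addr.
Qed.

(** The hypothesis excludes zero, whose expansion is empty. *)
Lemma bits_of_nat_cons (b : bool) m : 0 < m + b ->
  bits_of_nat (b + m.*2) = b :: bits_of_nat m.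
Proof.
rewrite -(bin_of_natK m) /bits_of_nat; case: (bin_of_nat m) => [|p] bm; first by case: b bm.
pose q := if b then BinNums.xI p else BinNums.xO p.
have -> : b + (nat_of_bin (BinNums.Npos p)).*2 = nat_of_bin (BinNums.Npos q).
  by rewrite /q; case: (b); rewrite /= NatTrec.doubleE.
by rewrite !nat_of_binK /q; case: (b).
Qed.

Lemma trim_value s : trim s = bits_of_nat (value s).
Proof.
elim: s => // b s IHs.
have -> : trim (b :: s) = if b then b :: trim s
   else if size (trim s) == 0 then [::] else b :: trim s by [].
rewrite IHs /=; case: b => [|]; first by rewrite bits_of_nat_cons ?addn1.
rewrite add0n; case: (posnP (value s)) => [->//|v_gt0].
rewrite (bits_of_nat_cons (b := false)) ?addn0 //.
case: eqP => // /size0nil bits0.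
suff : value s = 0 by lia.
move: bits0; rewrite /bits_of_nat -{2}[value s]bin_of_natK.
by case: (bin_of_nat _) => // -[].
Qed.

Lemma sz_bits (s : bits) : sz s <= (size s * 4).+1.
Proof. by apply: sz_seq_le; apply/allP => b _; apply: sz_bool. Qed.

Lemma ptime_foldl_bool E {eE : Enc E} A {eA : Enc A} (step : E -> bool -> A -> bool)
    (init : bool) (l : E -> seq A) :
  ptime (fun p : E * bool * A => step p.1.1 p.1.2 p.2) -> ptime l ->
  ptime (fun e => foldl (step e) init (l e)).
Proof.
move=> ps pl; apply: (@ptime_foldl _ _ _ _ _ _ step _ _ (fun=> 3)) => //.
- exact: ptime_const.
- exact: pbounded_const.
by move=> *; apply: sz_bool.
Qed.

Lemma ptime_carry E {eE : Enc E} (u : E -> nat) (x y : E -> bits) :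
  ptime u -> ptime x -> ptime y -> ptime (fun e => carry (x e) (y e) (u e)).
Proof.
move=> pu px py; apply: (ptime_foldl_bool (step := fun e c i =>
  if bit (x e) i == bit (y e) i then bit (x e) i else c)); rewrite /bit; ptime_tac.
Qed.

Lemma ptime_le_bits E {eE : Enc E} (x y : E -> bits) :
  ptime x -> ptime y -> ptime (fun e => le_bits (x e) (y e)).
Proof.
move=> px py; apply: (ptime_foldl_bool (step := fun e c i =>
  if bit (x e) i == bit (y e) i then c else bit (y e) i)); rewrite /bit; ptime_tac.
Qed.

Section BitPrograms.
Context (E : Type) {eE : Enc E}.
Implicit Types (u k L a : E -> nat) (x y : E -> bits).

Lemma ptime_add_bits u x y :
  ptime u -> ptime x -> ptime y -> ptime (fun e => add_bits (u e) (x e) (y e)).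
Proof.
move=> pu px py; rewrite /add_bits /bit; apply: ptime_map; last by ptime_tac.
by apply: ptime_addb; last apply: ptime_carry; ptime_tac.
Qed.

Lemma ptime_pow_bits u k :
  ptime u -> ptime k -> ptime (fun e => pow_bits (u e) (k e)).
Proof. by move=> pu pk; rewrite /pow_bits; ptime_tac. Qed.

Lemma ptime_digit_bits L a x :
  ptime L -> ptime a -> ptime x -> ptime (fun e => digit_bits (L e) (a e) (x e)).
Proof. by move=> pL pa px; rewrite /digit_bits /bit; ptime_tac. Qed.

End BitPrograms.

Lemma sz_add_bits u (s t : bits) : sz (add_bits u s t) <= (u * 4).+1.
Proof. by apply: leq_trans (sz_bits _) _; rewrite size_map size_iota. Qed.

Lemma ptime_mul_bits E {eE : Enc E} (u : E -> nat) (x y : E -> bits) :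
  ptime u -> ptime x -> ptime y -> ptime (fun e => mul_bits (u e) (x e) (y e)).
Proof.
move=> pu px py.
have bH : pbounded (fun e => (sz (u e) * 4).+1).
  apply: pbounded_S; apply: pbounded_mul; last exact: pbounded_const.
  exact: pbounded_ptime.
apply: (@ptime_foldr _ _ _ _ _ _ (fun e (b : bool) z => add_bits (u e)
   (if b then x e else [::]) (false :: z)) _ _ _ _ _ _ bH);
  [by apply: ptime_add_bits; ptime_tac | by ptime_tac | by ptime_tac | ].
move=> e l1 [|b l2] def_l //=; apply: leq_trans (sz_add_bits _ _ _) _.
by rewrite ltnS leq_mul // sz_nat; lia.
Qed.

Lemma sz_mul_bits u (s t : bits) : sz (mul_bits u s t) <= (u * 4).+1.
Proof. by case: t => //= b t; apply: sz_add_bits. Qed.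

Lemma ptime_sum_bits E {eE : Enc E} A {eA : Enc A} (u : E -> nat) (l : E -> seq A)
    (F : E -> A -> bits) :
  ptime u -> ptime l -> ptime (fun p : E * A => F p.1 p.2) ->
  ptime (fun e => sum_bits (u e) (l e) (F e)).
Proof.
move=> pu pl pF.
have bH : pbounded (fun e => (sz (u e) * 4).+1).
  apply: pbounded_S; apply: pbounded_mul; last exact: pbounded_const.
  exact: pbounded_ptime.
apply: (@ptime_foldr _ _ _ _ _ _ (fun e x z => add_bits (u e) (F e x) z) _ _ _ _ _ _ bH);
  [by apply: ptime_add_bits; ptime_tac | by ptime_tac | by ptime_tac | ].
move=> e l1 [|b l2] def_l //=; apply: leq_trans (sz_add_bits _ _ _) _.
by rewrite ltnS leq_mul // sz_nat; lia.
Qed.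

Lemma ptime_prod_bits E {eE : Enc E} A {eA : Enc A} (u : E -> nat) (l : E -> seq A)
    (F : E -> A -> bits) :
  ptime u -> ptime l -> ptime (fun p : E * A => F p.1 p.2) ->
  ptime (fun e => prod_bits (u e) (l e) (F e)).
Proof.
move=> pu pl pF.
have bH : pbounded (fun e => 5 + (sz (u e) * 4).+1).
  apply: pbounded_add; first exact: pbounded_const.
  apply: pbounded_S; apply: pbounded_mul; last exact: pbounded_const.
  exact: pbounded_ptime.
apply: (@ptime_foldr _ _ _ _ _ _ (fun e x z => mul_bits (u e) (F e x) z) _ _ _ _ _ _ bH);
  [by apply: ptime_mul_bits; ptime_tac | by ptime_tac | by ptime_tac | ].
move=> e l1 [|b l2] def_l //=; apply: leq_trans (sz_mul_bits _ _ _) _.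
by rewrite sz_nat; lia.
Qed.

Lemma ptime_trim E {eE : Enc E} (x : E -> bits) :
  ptime x -> ptime (fun e => trim (x e)).
Proof.
move=> px; apply: (@ptime_foldr _ _ _ _ _ _ (fun _ (b : bool) z => if b then b :: z
    else if size z == 0 then [::] else b :: z) _ _ _ _ _ _ (pbounded_ptime px));
  try by ptime_tac.
move=> e l1 l2 ->; apply: leq_trans (sz_catr _ _).
elim: l2 => // b l2; rewrite sz_cons /=; move: (foldr _ _ l2) => z le_z.
have := leq_trans le_z (leq_addl (sz b) _).
by case: (b); [|case: ifP => _]; rewrite ?sz_cons ?ltnS ?leq_add2l // => /leqW.
Qed.

Ltac ptime_defined ::=
  lazymatch goal with
  | |- ptime (fun e => le_bits (@?x e) (@?y e)) => apply (@ptime_le_bits _ _ x y)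
  | |- ptime (fun e => add_bits (@?u e) (@?x e) (@?y e)) =>
      apply (@ptime_add_bits _ _ u x y)
  | |- ptime (fun e => pow_bits (@?u e) (@?k e)) => apply (@ptime_pow_bits _ _ u k)
  | |- ptime (fun e => digit_bits (@?L e) (@?a e) (@?x e)) =>
      apply (@ptime_digit_bits _ _ L a x)
  | |- ptime (fun e => mul_bits (@?u e) (@?x e) (@?y e)) =>
      apply (@ptime_mul_bits _ _ u x y)
  | |- ptime (fun e => sum_bits (@?u e) (@?l e) (@?F e)) =>
      apply (@ptime_sum_bits _ _ _ _ u l F)
  | |- ptime (fun e => prod_bits (@?u e) (@?l e) (@?F e)) =>
      apply (@ptime_prod_bits _ _ _ _ u l F)
  | |- ptime (fun e => trim (@?x e)) => apply (@ptime_trim _ _ x)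
  end.

(** * The algorithm *)

(* Size, rows of the adjacency matrix, thresholds, players, actor, and the value
   to which the actor's decision is restricted. *)
Definition config : Type := nat * seq (seq bool) * seq nat * seq bool * nat * bool.

Section Program.
Variable c : config.
Implicit Types (P : seq bits) (v w a m : nat) (d : bool).

Definition order := c.1.1.1.1.1.
Definition indices := iota 0 order.
Definition arc v w := nth false (nth [::] c.1.1.1.1.2 v) w.
Definition threshold v := nth 0 c.1.1.1.2 v.
Definition is_player v := nth false c.1.1.2 v.
Definition allowed v d := ~~ (v == c.1.2) || (d == c.2).

Definition indegree v := count (fun u => arc u v) indices.
Definition twins v w := all (fun u => arc u v == arc u w) indices.
(* The least vertex of a class stores the number of the class and the others store
   1, so that a product over a set of predecessors counts every class once. *)
Definition leader v := all (fun w => ~~ twins v w) (iota 0 v).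

(* Numbers of decisions are kept in the exponent of Z = 2 ^ zwidth, numbers of
   active vertices in the exponent of Y = 2 ^ ywidth. *)
Definition zwidth := order.+1.
Definition ywidth := zwidth * zwidth.
Definition width := zwidth * ywidth.

Definition choice_bits v e0 e1 : bits :=
  add_bits width (if allowed v false then pow_bits width e0 else [::])
                 (if allowed v true then pow_bits width e1 else [::]).

Definition verdict v m a d : bool :=
  if (threshold v <= a) && ~~ (threshold v <= m - a) then true
  else if (threshold v <= m - a) && ~~ (threshold v <= a) then false
  else d.

Definition member_bits m a w : bits :=
  choice_bits w (if verdict w m a false then zwidth else 0)
                (if verdict w m a true then zwidth else 0).

(** The spread is seeded by players only, so the activity of a class of other vertices depends on
    [a] and not on their decisions. It contributes one common power of Y, outside the product over
    the members. *)
Definition activated v a := count (fun w => twins v w && (threshold w <= a)) indices.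

Definition below_bits P v : bits :=
  prod_bits width indices (fun u => if arc u v then nth [::] P u else [:: true]).

(** The range of [a] has length [zwidth] because there are n + 1 possible counts. *)
Definition group_bits P v : bits :=
  sum_bits width (iota 0 zwidth) (fun a =>
    mul_bits width (pow_bits width (ywidth * activated v a))
      (mul_bits width (digit_bits ywidth a (below_bits P v))
        (prod_bits width indices (fun w =>
          if twins v w then member_bits (indegree v) a w else [:: true])))).

(** A player deciding 1 is active and has final decision 1, hence the factor Y * Z. Players are
    independent, so each keeps its own number instead of sharing one per class. *)
Definition vertex_bits P v : bits :=
  if is_player v then choice_bits v 0 (ywidth + zwidth)
  else if leader v then group_bits P v else [:: true].

Definition round_bits P : seq bits := [seq vertex_bits P v | v <- indices].

(** The missing entries of the initial list are read as 0. After t rounds the numbers belonging to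
    stages with at most t vertices are final, whatever the others hold. *)
Definition rounds t := iter t round_bits [::].

Definition final_bits := rounds order.

Definition total_bits : bits :=
  prod_bits width indices (fun u =>
    if all (fun w => ~~ arc u w) indices then nth [::] final_bits u else [:: true]).

(** Adding up the coefficients of the powers of y amounts to setting y to 1; a polynomial in z
    remains. *)
Definition profile_bits : bits :=
  sum_bits width (iota 0 zwidth) (fun a => digit_bits ywidth a total_bits).

End Program.

Lemma ptime_round_bits E {eE : Enc E} (c : E -> config) (P : E -> seq bits) :
  ptime c -> ptime P -> ptime (fun e => round_bits (c e) (P e)).
Proof.
move=> pc pP.
rewrite /round_bits /vertex_bits /group_bits /below_bits /member_bits /choice_bits.
rewrite /activated /verdict /leader /twins /indegree /allowed /is_player /threshold.
rewrite /width /ywidth /zwidth /arc /indices /order.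
by ptime_tac.
Qed.

Lemma sz_vertex_bits c P v : sz (vertex_bits c P v) <= (width c * 4) + 5.
Proof.
rewrite /vertex_bits; case: ifP => _; last case: ifP => _.
- by apply: leq_trans (sz_add_bits _ _ _) _; rewrite -addn1 leq_add2l.
- rewrite /group_bits; case: (iota _ _) => [|a l]; first by rewrite /sz /= addnC.
  by apply: leq_trans (sz_add_bits _ _ _) _; rewrite -addn1 leq_add2l.
exact: leq_addl.
Qed.

Lemma ptime_final_bits : ptime final_bits.
Proof.
have po : ptime order by rewrite /order; ptime_tac.
have pw : ptime width.
  by rewrite /width /ywidth /zwidth /order; ptime_tac.
have bH : pbounded (fun c => sz (order c) * (sz (width c) * 4 + 5).+1 + 1).
  apply: pbounded_add; last exact: pbounded_const.
  apply: pbounded_mul; first exact: pbounded_ptime.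
  apply: pbounded_S; apply: pbounded_add; last exact: pbounded_const.
  by apply: pbounded_mul; [exact: pbounded_ptime | exact: pbounded_const].
apply: (ptime_iter (step := round_bits) _ _ po bH).
- by apply: ptime_round_bits; ptime_tac.
- exact: ptime_const.
move=> c [|i] _; first by rewrite addn1.
rewrite iterS addn1; apply: leq_trans (@sz_seq_le _ _ (width c * 4 + 5) _ _) _.
  by apply/allP => s /mapP[v _ ->]; apply: sz_vertex_bits.
rewrite size_map size_iota ltnS !sz_nat; nia.
Qed.

Lemma ptime_profile_bits : ptime profile_bits.
Proof.
have pf := ptime_final_bits.
rewrite /profile_bits /total_bits /width /ywidth /zwidth /arc /indices /order.
by ptime_tac.
Qed.

(* The least a <= n with r.1 <= a * r.2, and n.+1 if there is none; it turns the
   label r.1 / r.2 into an integer threshold, and decodes r.1 when r.2 = 1. *)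
Definition rank n (r : bits * bits) : nat :=
  find (fun a => le_bits r.1 (sum_bits (size r.2 + n) (iota 0 a) (fun=> r.2)))
    (iota 0 n.+1).

Definition raw_instance : Type :=
  seq (seq bool) * (seq (bits * bits) * (bits * (seq bool * bits))).

Definition config_of (x : raw_instance) (d : bool) : config :=
  (size x.1, x.1, [seq rank (size x.1) r | r <- x.2.1], x.2.2.2.1,
   rank (size x.1) (x.2.2.2.2, [:: true]), d).

(* The number of decision vectors x with x_i = c.2 = C(x), where i is the actor. *)
Definition agreement_bits (c : config) (q : nat) : bits :=
  sum_bits (width c) (iota 0 (zwidth c)) (fun k =>
    if (q <= k) == c.2 then digit_bits (zwidth c) k (profile_bits c) else [::]).

Definition solve (x : raw_instance) : bits :=
  let q := rank (size x.1) (x.2.2.1, [:: true]) in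
  trim (add_bits (width (config_of x true))
    (agreement_bits (config_of x true) q) (agreement_bits (config_of x false) q)).

Lemma ptime_rank E {eE : Enc E} (n : E -> nat) (r : E -> bits * bits) :
  ptime n -> ptime r -> ptime (fun e => rank (n e) (r e)).
Proof. by move=> pn pr; rewrite /rank; ptime_tac. Qed.

Lemma ptime_config_of (d : bool) : ptime (config_of^~ d).
Proof.
have prank : ptime (fun p : nat * (bits * bits) => rank p.1 p.2).
  by apply: ptime_rank; ptime_tac.
by rewrite /config_of; ptime_tac.
Qed.

Lemma ptime_agreement_bits E {eE : Enc E} (c : E -> config) (q : E -> nat) :
  ptime c -> ptime q -> ptime (fun e => agreement_bits (c e) (q e)).
Proof.
move=> pc pq; have pp := ptime_profile_bits.
by rewrite /agreement_bits /width /ywidth /zwidth /order; ptime_tac.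
Qed.

Lemma ptime_solve : ptime solve.
Proof.
have pq : ptime (fun x : raw_instance => rank (size x.1) (x.2.2.1, [:: true])).
  by apply: ptime_rank; ptime_tac.
apply: ptime_trim; apply: ptime_add_bits.
- apply: ptime_comp (ptime_config_of true) _.
  by rewrite /width /ywidth /zwidth /order; ptime_tac.
- by apply: ptime_agreement_bits (ptime_config_of true) pq.
- by apply: ptime_agreement_bits (ptime_config_of false) pq.
Qed.

(** * Generating functions of strong hierarchical games *)

Lemma sum_subsetU (T : finType) (V1 V2 : {set T}) (F : {set T} -> nat) :
  [disjoint V1 & V2] ->
  \sum_(X : {set T} | X \subset V1 :|: V2) F X =
  \sum_(X1 : {set T} | X1 \subset V1) \sum_(X2 : {set T} | X2 \subset V2) F (X1 :|: X2).
Proof.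
move=> dis; rewrite pair_big /=.
have U12 (X1 X2 : {set T}) : X1 \subset V1 -> X2 \subset V2 ->
    ((X1 :|: X2) :&: V1 = X1) * ((X1 :|: X2) :&: V2 = X2).
  move=> s1 s2; rewrite !setIUl (setIidPl s1) (setIidPl s2).
  have /disjoint_setI0 -> : [disjoint X1 & V2] by apply: disjointWl dis.
  have /disjoint_setI0 -> : [disjoint X2 & V1].
    by apply: disjointWl s2 _; rewrite disjoint_sym.
  by rewrite setU0 set0U.
rewrite (reindex_onto (fun p : {set T} * {set T} => p.1 :|: p.2)
  (fun X => (X :&: V1, X :&: V2))) /=; last first.
  by move=> X sX; rewrite -setIUr (setIidPl sX).
apply: eq_bigl => -[X1 X2] /=; apply/andP/andP => -[h1 h2].
  by move/eqP: h2 => [<- <-]; rewrite !subsetIr.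
by rewrite setUSS // !U12.
Qed.

Lemma sum_subset_prod (T : finType) (W : {set T}) (phi : T -> bool -> nat) :
  \sum_(X : {set T} | X \subset W) \prod_(w in W) phi w (w \in X) =
  \prod_(w in W) (phi w false + phi w true).
Proof.
(* The values 0 and 1 outside [W] extend the product to the whole type and annihilate the terms of
   sets not contained in [W]. *)
pose F w := if w \in W then phi w true else 0.
pose F' w := if w \in W then phi w false else 1.
transitivity (\prod_w (F w + F' w)); last first.
  rewrite [RHS]big_mkcond; apply: eq_bigr => w _; rewrite /F /F'.
  by case: ifP => _ //; rewrite addnC.
rewrite bigA_distr big_mkcond; apply: eq_bigr => X _.
case: ifP => [sX|/negbT/subsetPn[w wX wW]].
  rewrite big_mkcond; apply: eq_bigr => w _; rewrite /F /F'.
  case: (boolP (w \in W)) => wW; case: (boolP (w \in X)) => //.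
  by move=> /(subsetP sX); rewrite (negPf wW).
by rewrite (bigD1 w) //= wX /F (negPf wW) mul0n.
Qed.

Lemma prod_exp_mem (T : finType) (W : {set T}) (p : pred T) (y : nat) :
  \prod_(w in W) y ^ p w = y ^ #|[set w in W | p w]|.
Proof.
rewrite -expn_sum; congr (_ ^ _); rewrite -sum1_card [RHS]big_mkcond [LHS]big_mkcond.
by apply: eq_bigr => w _; rewrite inE; case: (w \in W); case: (p w).
Qed.

(** Since the total weight is below y, no carries occur: terms with exponent below a sum to less
    than y ^ a, and those with exponent above a form a multiple of y ^ (a + 1). *)
Lemma weighted_digit (I : finType) (P : pred I) (A e : I -> nat) (y a : nat) :
  \sum_(i | P i) A i < y ->
  ((\sum_(i | P i) A i * y ^ e i) %/ y ^ a) %% y = \sum_(i | P i && (e i == a)) A i.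
Proof.
move=> ltA; have y_gt0 : 0 < y by apply: leq_ltn_trans ltA.
have ya_gt0 : 0 < y ^ a by rewrite expn_gt0 y_gt0.
have sub_lt (Q : pred I) : \sum_(i | P i && Q i) A i < y.
  by apply: leq_ltn_trans ltA; rewrite [leqRHS](bigID Q) leq_addr.
rewrite (bigID (fun i => e i < a)) /=.
set lo := \sum_(i | P i && (e i < a)) _.
have lt_lo : lo < y ^ a.
  rewrite /lo; case: (posnP a) => [->|a_gt0].
    by rewrite big_pred0 // => i; rewrite andbF.
  apply: (@leq_ltn_trans (\sum_(i | P i && (e i < a)) A i * y ^ a.-1)).
    apply: leq_sum => i /andP[_ lt_ia]; rewrite leq_mul2l leq_pexp2l ?orbT //.
    by rewrite -ltnS prednK.
  have -> : y ^ a = y * y ^ a.-1 by rewrite -expnS prednK.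
  by rewrite -big_distrl /= ltn_pmul2r // expn_gt0 y_gt0.
rewrite (bigID (fun i => e i == a)) /=.
have -> : \sum_(i | P i && ~~ (e i < a) && (e i == a)) A i * y ^ e i
    = y ^ a * \sum_(i | P i && (e i == a)) A i.
  rewrite big_distrr /=; apply: eq_big => [i|i /andP[_ /eqP->]]; last by rewrite mulnC.
  by case: ltngtP; rewrite ?andbT ?andbF.
set hi := \sum_(i | _ && (e i != a)) _.
have [M ->] : exists M, hi = y ^ a * (y * M).
  exists (\sum_(i | P i && ~~ (e i < a) && (e i != a)) A i * y ^ (e i - a.+1)).
  rewrite mulnA -expnSr big_distrr /=; apply: eq_bigr => i.
  case/andP=> /andP[_]; rewrite -leqNgt => le_ai ne_ia.
  have lt_ai : a < e i by rewrite ltn_neqAle eq_sym ne_ia.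
  by rewrite mulnCA -expnD subnKC.
rewrite -mulnDr addnC mulnC divnMDl // (divn_small lt_lo) addn0.
by rewrite addnC mulnC modnMDl modn_small.
Qed.

(** * Stages of the construction and their predecessor classes *)

Section Structure.
Variable T : finType.
Implicit Types (G H K : digraph T) (u v w : T) (W : {set T}).

Lemma FIsetE G : FIset G = [set v in vertices G | succs G v == set0].
Proof.
by apply/setP => v; rewrite !inE -andb_orr -andb_orr orbC orbN andbT.
Qed.

Lemma strong_hierarchical_arcs G :
  strong_hierarchical G -> arcs G \subset setX (vertices G) (vertices G).
Proof.
elim=> {G} [W _|H1 H2 _ s1 _ s2 _|H W _ sH _ _] /=; first exact: sub0set.
  apply/subsetP => -[u v] /setUP[/(subsetP s1)|/(subsetP s2)];
    by rewrite !inE => /andP[-> ->]; rewrite ?orbT.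
apply/subsetP => -[u v] /setUP[/(subsetP sH)|].
  by rewrite !inE => /andP[-> ->].
by rewrite FIsetE !inE => /andP[/andP[-> _] ->]; rewrite orbT.
Qed.

Lemma preds_vertices G u v :
  strong_hierarchical G -> u \in preds G v -> (u \in vertices G) && (v \in vertices G).
Proof. by move/strong_hierarchical_arcs/subsetP => sG; rewrite inE => /sG; rewrite inE. Qed.

Lemma mem_succs G u v : (v \in succs G u) = (u \in preds G v).
Proof. by rewrite !inE. Qed.

(** Hence joined vertices have predecessors, so they are not players, and their predecessor set
    identifies the join. *)
Lemma FIset_neq0 G : strong_hierarchical G -> FIset G != set0.
Proof.
elim=> {G} [W nW|H1 H2 sh1 n1 sh2 _ dis|H W shH _ /set0Pn[w wW] dis].
- case/set0Pn: nW => w wW; apply/set0Pn; exists w; rewrite FIsetE inE wW /=.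
  by apply/eqP/setP => u; rewrite !inE.
- case/set0Pn: n1 => u; rewrite FIsetE inE => /andP[u1 /eqP s1].
  apply/set0Pn; exists u; rewrite FIsetE !inE u1 /=.
  apply/eqP/setP => v; rewrite !inE; apply/negP => /orP[uv|uv].
    by have := in_set0 v; rewrite -s1 inE uv.
  have /(preds_vertices sh2)/andP[u2 _] : u \in preds H2 v by rewrite inE.
  by have /disjointFr/(_ u1) := dis; rewrite u2.
- apply/set0Pn; exists w; rewrite FIsetE !inE wW orbT /=.
  have wH : (w \in vertices H) = false by rewrite (disjointFl dis).
  apply/eqP/setP => v; rewrite FIsetE !inE wH /= orbF; apply/negP => uv.
  have /(preds_vertices shH) : w \in preds H v by rewrite inE.
  by rewrite wH.
Qed.

Variable G : digraph T.

(* H is a stage in the construction of G: only the vertices of FIset H may still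
   receive successors. *)
Definition stage H : Prop :=
  [/\ strong_hierarchical H, {in vertices H, preds G =1 preds H}
    & {in vertices H :\: FIset H, succs G =1 succs H}].

Lemma FIset_union H1 H2 :
  strong_hierarchical H1 -> strong_hierarchical H2 ->
  [disjoint vertices H1 & vertices H2] ->
  FIset (Digraph (vertices H1 :|: vertices H2) (arcs H1 :|: arcs H2)) =
  FIset H1 :|: FIset H2.
Proof.
move=> sh1 sh2 dis; set H := Digraph _ _.
have sE u : succs H u = succs H1 u :|: succs H2 u.
  by apply/setP => v; rewrite !inE.
have s1 u : u \notin vertices H1 -> succs H1 u = set0.
  move=> nu; apply/setP => v; rewrite mem_succs in_set0; apply/negP.
  by move/(preds_vertices sh1); rewrite (negPf nu).
have s2 u : u \notin vertices H2 -> succs H2 u = set0.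
  move=> nu; apply/setP => v; rewrite mem_succs in_set0; apply/negP.
  by move/(preds_vertices sh2); rewrite (negPf nu).
apply/setP => u; rewrite !FIsetE !inE sE setU_eq0.
case: (boolP (u \in vertices H1)) => u1 /=.
  by rewrite (disjointFr dis u1) orbF s2 ?eqxx ?andbT // (disjointFr dis u1).
by rewrite s1 // eqxx.
Qed.

(** As [W] is nonempty, every vertex of [FIset H] acquires a successor, so [W] replaces the old set
    entirely. *)
Lemma FIset_join H W :
  strong_hierarchical H -> W != set0 -> [disjoint vertices H & W] ->
  FIset (Digraph (vertices H :|: W) (arcs H :|: setX (FIset H) W)) = W.
Proof.
move=> shH /set0Pn[w wW] dis; apply/setP => u; rewrite FIsetE inE.
case: (boolP (u \in W)) => uW.
  have uH : (u \in vertices H) = false by rewrite (disjointFl dis).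
  rewrite inE uW orbT /=; apply/eqP/setP => v; rewrite FIsetE !inE uH orbF.
  apply/negP => uv; have /(preds_vertices shH) : u \in preds H v by rewrite inE.
  by rewrite uH.
rewrite !inE (negPf uW) orbF; apply/negP => /andP[uH /eqP/setP su].
have /eqP succs0 : succs H u == set0.
  apply/eqP/setP => v; have := su v; rewrite !inE.
  by case: (_ \in arcs H).
by have := su w; rewrite FIsetE !inE uH succs0 eqxx wW orbT.
Qed.

Lemma stage_union1 H1 H2 :
  strong_hierarchical H1 -> strong_hierarchical H2 ->
  [disjoint vertices H1 & vertices H2] ->
  stage (Digraph (vertices H1 :|: vertices H2) (arcs H1 :|: arcs H2)) -> stage H1.
Proof.
move=> sh1 sh2 dis; set H := Digraph _ _ => -[_ pG sG].
have n2 u : u \in vertices H1 -> u \in vertices H2 = false by move=> /(disjointFr dis).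
split=> // v v1; first rewrite pG ?inE ?v1 //; last rewrite sG.
- apply/setP => u; rewrite !inE; case: (_ \in arcs H1) => //=.
  apply/negP => uv; have /(preds_vertices sh2)/andP[_] : u \in preds H2 v by rewrite inE.
  by rewrite n2.
- have {}v1 : v \in vertices H1 by case/setDP: v1.
  apply/setP => u; rewrite !inE; case: (_ \in arcs H1) => //=.
  apply/negP => uv; have /(preds_vertices sh2)/andP[] : v \in preds H2 u by rewrite inE.
  by rewrite n2.
case/setDP: v1 => v1 nv; rewrite FIset_union // in_setD in_setU (negPf nv).
by rewrite FIsetE !inE n2 // v1.
Qed.

Lemma stage_union2 H1 H2 :
  strong_hierarchical H1 -> strong_hierarchical H2 ->
  [disjoint vertices H1 & vertices H2] ->
  stage (Digraph (vertices H1 :|: vertices H2) (arcs H1 :|: arcs H2)) -> stage H2.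
Proof.
move=> sh1 sh2; rewrite disjoint_sym setUC [arcs H1 :|: _]setUC => dis.
exact: stage_union1.
Qed.

Lemma stage_join H W :
  strong_hierarchical H -> W != set0 -> [disjoint vertices H & W] ->
  stage (Digraph (vertices H :|: W) (arcs H :|: setX (FIset H) W)) -> stage H.
Proof.
move=> shH nW dis; set K := Digraph _ _ => -[_ pG sG].
have nvW v : v \in vertices H -> (v \in W) = false by move=> /(disjointFr dis).
split=> // v vH.
  by rewrite pG ?inE ?vH //; apply/setP => u; rewrite !inE nvW // andbF orbF.
case/setDP: vH => vH nv; rewrite sG; last first.
  by rewrite FIset_join // !inE vH nvW.
by apply/setP => u; rewrite inE /= in_setU in_setX (negPf nv) orbF inE.
Qed.

Lemma stage_join_preds H W w :
  strong_hierarchical H -> [disjoint vertices H & W] ->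
  stage (Digraph (vertices H :|: W) (arcs H :|: setX (FIset H) W)) ->
  w \in W -> preds G w = FIset H.
Proof.
move=> shH dis [_ pG _] wW; rewrite pG ?inE ?wW ?orbT //.
apply/setP => u; rewrite inE /= in_setU in_setX wW andbT.
have wH : w \in vertices H = false by rewrite (disjointFl dis).
case: (boolP ((u, w) \in arcs H)) => //= uw.
have /(preds_vertices shH) : u \in preds H w by rewrite inE.
by rewrite wH andbF.
Qed.

(** A vertex of [FIset H] leaves the frontier at the join, so its successors in G are exactly [W].
    Any vertex with predecessor set [FIset H] is such a successor; thus G alone reveals the sets
    used in joins. *)
Lemma stage_join_twins H W v :
  strong_hierarchical H -> W != set0 -> [disjoint vertices H & W] ->
  stage (Digraph (vertices H :|: W) (arcs H :|: setX (FIset H) W)) ->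
  (preds G v == FIset H) = (v \in W).
Proof.
move=> shH nW dis stK; apply/eqP/idP => [pv|]; last exact: stage_join_preds.
have /set0Pn[u uFI] := FIset_neq0 shH.
have uH : u \in vertices H by move: uFI; rewrite FIsetE inE => /andP[].
have [_ _ sG] := stK.
have : v \in succs G u by rewrite mem_succs pv.
rewrite sG; last by rewrite FIset_join // !inE uH (disjointFr dis uH).
have : succs H u = set0 by move: uFI; rewrite FIsetE inE => /andP[_ /eqP].
move/setP/(_ v); rewrite in_set0 inE => nuv.
by rewrite inE /= in_setU in_setX nuv uFI.
Qed.

End Structure.

(** * Spread of influence and final decisions *)

Section Spread.
Variables (T : finType) (Gam : game_data T).
Implicit Types (X Y : {set T}) (v : T).

Notation G := (graph Gam).
Notation f := (label Gam).

Lemma iter_spread_sub i j Y : i <= j ->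
  iter i (spread_step Gam) Y \subset iter j (spread_step Gam) Y.
Proof.
move/subnK <-; elim: (j - i) => // k IHk; rewrite addSn iterS.
by apply: subset_trans IHk _; apply: subsetUl.
Qed.

(** Until they stabilise the iterates grow strictly, so the iterate i + 1 would have more than i
    elements; this is impossible for i = #|T|. *)
Lemma spread_fixed Y : spread_step Gam (spread Gam Y) = spread Gam Y.
Proof.
pose S i := iter i (spread_step Gam) Y.
have grow i : S i.+1 = S i \/ i < #|S i.+1|.
  elim: i => [|i [eqS|ltS]].
  - case: (eqVneq (S 1) (S 0)) => [|neS]; [by left | right].
    have : S 0 \proper S 1 by rewrite properEneq eq_sym neS iter_spread_sub.
    by move/proper_card; apply: leq_trans.
  - by left; rewrite /S iterS -/(S i.+1) eqS.
  case: (eqVneq (S i.+2) (S i.+1)) => [|neS]; [by left | right].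
  have : S i.+1 \proper S i.+2 by rewrite properEneq eq_sym neS iter_spread_sub.
  by move/proper_card; apply: leq_trans.
by case: (grow #|T|) => //; rewrite ltnNge max_card.
Qed.

Lemma mem_spread Y v :
  v \in spread Gam Y =
  (v \in Y) || (f v <= (#|preds G v :&: spread Gam Y|)%:R)%R.
Proof.
apply/idP/orP => [|[vY|fv]]; last 2 first.
- by apply: (subsetP (iter_spread_sub Y (leq0n _))).
- by rewrite -spread_fixed !inE fv orbT.
have: forall i, i <= #|T| -> v \in iter i (spread_step Gam) Y ->
    v \in Y \/ (f v <= (#|preds G v :&: spread Gam Y|)%:R)%R.
  elim=> [|i IHi] le_i; first by left.
  rewrite iterS in_setU => /orP[/IHi|]; first by apply; apply: ltnW.
  rewrite inE => fv; right; apply: le_trans fv _.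
  by rewrite ler_nat subset_leq_card // setIS // iter_spread_sub // ltnW.
exact.
Qed.

(** Stages are closed under predecessors, so their activity can be computed without the rest of the
    graph. *)
Lemma spread_local (V : {set T}) Y Y' :
  {in V, forall v, preds G v \subset V} -> Y :&: V = Y' :&: V ->
  {in V, spread Gam Y =i spread Gam Y'}.
Proof.
move=> closedV eqY; rewrite /spread; elim: #|T| => [|i IHi] v vV.
  by have /setP/(_ v) := eqY; rewrite !inE vV !andbT.
rewrite !iterS !in_setU IHi // !inE; congr (_ || (_ <= _%:R)%R); apply: eq_card => u.
rewrite !in_setI; case: (boolP (u \in preds G v)) => //= uv.
by rewrite IHi // (subsetP (closedV _ vV)).
Qed.

Definition active X := spread Gam (X :&: players Gam).

Definition tipped v (p q : nat) (d : bool) : bool :=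
  if (f v <= p%:R)%R && (q%:R < f v)%R then true
  else if (f v <= q%:R)%R && (p%:R < f v)%R then false else d.

(** For players this is the bare decision instead of membership in the spread; [final_decisionE]
    shows that the two agree. *)
Definition decides X v : bool :=
  if v \in players Gam then v \in X
  else tipped v #|preds G v :&: active X| #|preds G v :\: active X| (v \in X).

Lemma active_local (V : {set T}) X X' :
  {in V, forall v, preds G v \subset V} -> X :&: V = X' :&: V ->
  {in V, active X =i active X'}.
Proof.
by move=> closedV eqX; apply: spread_local closedV _; rewrite !(setIAC _ _ V) eqX.
Qed.

Lemma decides_local (V : {set T}) X X' :
  {in V, forall v, preds G v \subset V} -> X :&: V = X' :&: V ->
  {in V, decides X =1 decides X'}.
Proof.
move=> closedV eqX v vV; have eqA := active_local closedV eqX.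
have vX : (v \in X) = (v \in X').
  by have /setP/(_ v) := eqX; rewrite !inE vV !andbT.
have eqp u : u \in preds G v -> (u \in active X) = (u \in active X').
  by move=> uv; rewrite eqA // (subsetP (closedV _ vV)).
rewrite /decides vX; congr (if _ then _ else tipped _ _ _ _); apply: eq_card => u.
  by rewrite !in_setI; case: (boolP (u \in preds G v)) => //= /eqp.
by rewrite !in_setD; case: (boolP (u \in preds G v)); rewrite ?andbF // => /eqp ->.
Qed.

(** The sets L(G) and I(G) together consist of the vertices without predecessors. *)
Hypothesis players_preds : forall v, (v \in players Gam) = (preds G v == set0).
Hypothesis label_gt0 : forall v, (0 < f v)%R.

(** With label 0 a vertex without predecessors would become active spontaneously; positivity rules
    this out. *)
Lemma active_player X v : v \in players Gam -> (v \in active X) = (v \in X).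
Proof.
move=> vN; rewrite /active mem_spread in_setI vN andbT.
move: vN; rewrite players_preds => /eqP ->.
by rewrite set0I cards0 leNgt label_gt0 orbF.
Qed.

Lemma active_nonplayer X v : v \notin players Gam ->
  (v \in active X) = (f v <= (#|preds G v :&: active X|)%:R)%R.
Proof. by move=> vN; rewrite {1}/active mem_spread in_setI (negPf vN) andbF. Qed.

End Spread.

Lemma prod_setU (T : finType) (V1 V2 : {set T}) (F : T -> nat) :
  [disjoint V1 & V2] ->
  \prod_(v in V1 :|: V2) F v = (\prod_(v in V1) F v) * \prod_(v in V2) F v.
Proof. by move=> dis; rewrite -bigU //; apply: eq_bigl => v; rewrite !inE. Qed.

(** * The generating function of a stage *)

Section Counting.
Variables (T : finType) (Gam : game_data T) (ok : T -> bool -> bool) (y z : nat).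
Implicit Types (X : {set T}) (H : digraph T) (v w : T).

Notation G := (graph Gam).
Notation f := (label Gam).

(** A forbidden decision makes the whole weight vanish; [gen] below is then the number S(H) for the
    allowed decisions. *)
Definition weight H X : nat :=
  \prod_(v in vertices H) (ok v (v \in X) * z ^ decides Gam X v).

Definition gen H : nat :=
  \sum_(X : {set T} | X \subset vertices H)
    weight H X * y ^ #|FIset H :&: active Gam X|.

(** The factor of one vertex of a joined class, summed over its own decision, when [a] of its [m]
    predecessors are active. *)
Definition member m a w : nat :=
  ok w false * z ^ tipped Gam w a (m - a) false +
  ok w true * z ^ tipped Gam w a (m - a) true.

Lemma stage_closed H : stage G H ->
  {in vertices H, forall v, preds G v \subset vertices H}.
Proof.
move=> [shH pG _] v vH; apply/subsetP => u; rewrite pG //.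
by case/(preds_vertices shH)/andP.
Qed.

Lemma weight_local H X X' : stage G H ->
  X :&: vertices H = X' :&: vertices H -> weight H X = weight H X'.
Proof.
move=> stH eqX; apply: eq_bigr => v vH.
rewrite (decides_local (stage_closed stH) eqX) //.
by have /setP/(_ v) := eqX; rewrite !in_setI vH !andbT => ->.
Qed.

Lemma FIset_active_local H X X' : stage G H ->
  X :&: vertices H = X' :&: vertices H ->
  FIset H :&: active Gam X = FIset H :&: active Gam X'.
Proof.
move=> stH eqX; apply/setP => v; rewrite !in_setI FIsetE inE.
by case: (boolP (v \in vertices H)) => //= /(active_local (stage_closed stH) eqX) ->.
Qed.

Hypothesis players_preds : forall v, (v \in players Gam) = (preds G v == set0).
Hypothesis label_gt0 : forall v, (0 < f v)%R.

Lemma gen_isolated W : stage G (Digraph W set0) ->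
  gen (Digraph W set0) = \prod_(w in W) (ok w false + ok w true * (z * y)).
Proof.
move=> [_ pG _]; have plW w : w \in W -> w \in players Gam.
  move=> wW; rewrite players_preds pG //; apply/eqP/setP => u.
  by rewrite inE /= !in_set0.
have FIW : FIset (Digraph W set0) = W.
  apply/setP => w; rewrite FIsetE inE /=; case: (w \in W) => //=.
  by apply/eqP/setP => u; rewrite inE /= !in_set0.
have -> : \prod_(w in W) (ok w false + ok w true * (z * y)) =
    \prod_(w in W) (ok w false * (z * y) ^ false + ok w true * (z * y) ^ true).
  by apply: eq_bigr => w _; rewrite expn0 muln1 expn1.
rewrite -(sum_subset_prod W (fun w d => ok w d * (z * y) ^ d)); apply: eq_bigr => X _.
have -> : FIset (Digraph W set0) :&: active Gam X = [set w in W | w \in X].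
  apply/setP => w; rewrite in_setI FIW inE; case: (boolP (w \in W)) => //= /plW.
  exact: active_player.
rewrite -prod_exp_mem -big_split; apply: eq_bigr => w /plW wN /=.
by rewrite /decides wN expnMn mulnA.
Qed.

Lemma gen_union H1 H2 :
  strong_hierarchical H1 -> strong_hierarchical H2 ->
  [disjoint vertices H1 & vertices H2] ->
  stage G (Digraph (vertices H1 :|: vertices H2) (arcs H1 :|: arcs H2)) ->
  gen (Digraph (vertices H1 :|: vertices H2) (arcs H1 :|: arcs H2)) =
  gen H1 * gen H2.
Proof.
move=> sh1 sh2 dis stH; have st1 := stage_union1 sh1 sh2 dis stH.
have st2 := stage_union2 sh1 sh2 dis stH.
rewrite /gen FIset_union // /= sum_subsetU // big_distrl; apply: eq_bigr => X1 s1.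
rewrite big_distrr; apply: eq_bigr => X2 s2 /=.
have dis12 : [disjoint X1 & vertices H2] by apply: disjointWl dis.
have dis21 : [disjoint X2 & vertices H1].
  by apply: disjointWl s2 _; rewrite disjoint_sym.
have eq1 : (X1 :|: X2) :&: vertices H1 = X1 :&: vertices H1.
  by rewrite setIUl (disjoint_setI0 dis21) setU0.
have eq2 : (X1 :|: X2) :&: vertices H2 = X2 :&: vertices H2.
  by rewrite setIUl (disjoint_setI0 dis12) set0U.
have -> : weight (Digraph (vertices H1 :|: vertices H2) (arcs H1 :|: arcs H2))
    (X1 :|: X2) = weight H1 X1 * weight H2 X2.
  rewrite -(weight_local st1 eq1) -(weight_local st2 eq2).
  by rewrite /weight /= (prod_setU _ dis).
rewrite setIUl cardsU.
have -> : FIset H1 :&: active Gam (X1 :|: X2) :&: (FIset H2 :&: active Gam (X1 :|: X2))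
    = set0.
  apply/setP => v; rewrite !in_setI in_set0 !FIsetE !inE; apply/negP.
  by case/andP=> /andP[/andP[v1 _] _] /andP[/andP[]]; rewrite (disjointFr dis v1).
rewrite cards0 subn0 expnD (FIset_active_local st1 eq1) (FIset_active_local st2 eq2).
by rewrite mulnACA.
Qed.

(** Decisions on [H] are grouped by the number a of active vertices in [FIset H]. For fixed a the
    sum over the decisions on [W] factors over its vertices, and the bound by [y] lets
    [weighted_digit] read the total weight of the group off [gen H]. *)
Lemma gen_join H W :
  strong_hierarchical H -> W != set0 -> [disjoint vertices H & W] ->
  stage G (Digraph (vertices H :|: W) (arcs H :|: setX (FIset H) W)) ->
  \sum_(X : {set T} | X \subset vertices H) weight H X < y ->
  gen (Digraph (vertices H :|: W) (arcs H :|: setX (FIset H) W)) =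
  \sum_(a < #|T|.+1) y ^ #|[set w in W | (f w <= a%:R)%R]| *
    ((gen H %/ y ^ a) %% y * \prod_(w in W) member #|FIset H| a w).
Proof.
move=> shH nW dis stK lt_y; have stH := stage_join shH nW dis stK.
have pW := stage_join_preds shH dis stK.
have nplW w : w \in W -> w \notin players Gam.
  by move=> wW; rewrite players_preds pW // FIset_neq0.
set K := Digraph _ _; pose act X := #|FIset H :&: active Gam X|.
have step X1 : X1 \subset vertices H ->
    \sum_(X2 : {set T} | X2 \subset W)
      weight K (X1 :|: X2) * y ^ #|FIset K :&: active Gam (X1 :|: X2)| =
    weight H X1 * (y ^ #|[set w in W | (f w <= (act X1)%:R)%R]| *
      \prod_(w in W) member #|FIset H| (act X1) w).
  move=> s1; rewrite mulnCA.
  pose phi w d := ok w d * z ^ tipped Gam w (act X1) (#|FIset H| - act X1) d.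
  rewrite -[\prod_(w in W) _](sum_subset_prod W phi) !big_distrr /=.
  apply: eq_bigr => X2 s2.
  have dis12 : [disjoint X1 & W] by apply: disjointWl dis.
  have dis21 : [disjoint X2 & vertices H].
    by apply: disjointWl s2 _; rewrite disjoint_sym.
  have eq1 : (X1 :|: X2) :&: vertices H = X1 :&: vertices H.
    by rewrite setIUl (disjoint_setI0 dis21) setU0.
  have actE : #|FIset H :&: active Gam (X1 :|: X2)| = act X1.
    by rewrite (FIset_active_local stH eq1).
  have -> : FIset K :&: active Gam (X1 :|: X2) = [set w in W | (f w <= (act X1)%:R)%R].
    rewrite FIset_join //; apply/setP => w; rewrite in_setI inE.
    case: (boolP (w \in W)) => //= wW.
    by rewrite active_nonplayer ?nplW // pW // actE.
  rewrite mulnC; congr (_ * _).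
  rewrite {1}/weight /K /= (prod_setU _ dis) -/(weight H _) (weight_local stH eq1).
  congr (_ * _); apply: eq_bigr => w wW.
  have -> : (w \in X1 :|: X2) = (w \in X2).
    by rewrite in_setU (disjointFl dis12).
  by rewrite /decides (negPf (nplW _ wW)) pW // cardsD actE in_setU (disjointFl dis12).
have actT X : act X < #|T|.+1 by rewrite ltnS max_card.
have -> : gen K = \sum_(X1 : {set T} | X1 \subset vertices H)
    \sum_(X2 : {set T} | X2 \subset W)
      weight K (X1 :|: X2) * y ^ #|FIset K :&: active Gam (X1 :|: X2)|.
  exact: sum_subsetU.
rewrite (eq_bigr _ step).
rewrite (partition_big (fun X => Ordinal (actT X)) predT) //=; apply: eq_bigr => a _.
have -> : (gen H %/ y ^ a) %% y =
    \sum_(X : {set T} | (X \subset vertices H) && (act X == a)) weight H X.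
  exact: weighted_digit.
rewrite mulnCA big_distrl /=.
apply: eq_big => [X|X /andP[_ /eqP <-]]; last by [].
by rewrite -val_eqE.
Qed.

Lemma weight_le H X : 0 < z -> weight H X <= z ^ #|vertices H|.
Proof.
move=> z_gt0; rewrite -sum1_card expn_sum; apply: leq_prod => v _.
rewrite expn1 -[leqRHS]mul1n leq_mul ?leq_b1 //.
by case: decides; rewrite ?expn1.
Qed.

Lemma sum_weight_le H : 0 < z ->
  \sum_(X : {set T} | X \subset vertices H) weight H X <= 2 ^ #|T| * z ^ #|T|.
Proof.
move=> z_gt0.
have le_w X : weight H X <= z ^ #|T|.
  by apply: leq_trans (weight_le _ _ z_gt0) _; rewrite leq_pexp2l ?max_card.
apply: (@leq_trans (\sum_(X : {set T} | X \subset vertices H) z ^ #|T|)).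
  exact: leq_sum.
rewrite sum_nat_const leq_mul2r; apply/orP; right.
by apply: leq_trans (max_card _) _; rewrite -cardsT -powersetT card_powerset cardsT.
Qed.

Lemma gen_le H : 0 < z -> 0 < y -> gen H <= 2 ^ #|T| * z ^ #|T| * y ^ #|T|.
Proof.
move=> z_gt0 y_gt0.
apply: leq_trans (leq_mul (sum_weight_le H z_gt0) (leqnn _)).
by rewrite big_distrl leq_sum // => X _; rewrite leq_mul // leq_pexp2l ?max_card.
Qed.

End Counting.

(** * Convergence of the rounds *)

Section Rounds.
Variables (T : finType) (Gam : game_data T) (ok : T -> bool -> bool).
Variables (y z B : nat) (leader : pred T) (P : nat -> T -> nat).
Implicit Types (X : {set T}) (H : digraph T) (v w : T).

Notation G := (graph Gam).
Notation f := (label Gam).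

Hypothesis players_preds : forall v, (v \in players Gam) = (preds G v == set0).
Hypothesis label_gt0 : forall v, (0 < f v)%R.
Hypothesis z_gt0 : 0 < z.
Hypothesis y_large : 2 ^ #|T| * z ^ #|T| < y.
Hypothesis B_large : 2 ^ #|T| * z ^ #|T| * y ^ #|T| < B.
Hypothesis leader_exists : forall v, exists w, [/\ preds G w = preds G v, leader w
  & forall u, preds G u = preds G v -> leader u -> u = w].
Hypothesis P_player : forall t v, v \in players Gam ->
  P t.+1 v = ok v false + ok v true * (z * y).
Hypothesis P_follower : forall t v, v \notin players Gam -> ~~ leader v ->
  P t.+1 v = 1.
Hypothesis P_leader : forall t v, v \notin players Gam -> leader v ->
  P t.+1 v = (\sum_(a < #|T|.+1)
    y ^ #|[set w | (preds G v == preds G w) && (f w <= a%:R)%R]| *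
    (((\prod_(u in preds G v) P t u) %% B %/ y ^ a) %% y *
     \prod_(w | preds G v == preds G w) member Gam ok z #|preds G v| a w)) %% B.

(** A union needs no further round. A join needs one, and adds at least one vertex since [W] is
    nonempty, so the number of vertices bounds the number of rounds required. *)
Lemma prod_rounds H t : stage G H -> #|vertices H| <= t ->
  \prod_(v in FIset H) P t v = gen Gam ok y z H.
Proof.
have y_gt0 : 0 < y by apply: leq_ltn_trans y_large.
have gen_lt K : gen Gam ok y z K < B.
  exact: leq_ltn_trans (gen_le _ _ _ z_gt0 y_gt0) B_large.
move=> stH; have [shH _ _] := stH; move: stH.
elim: shH t => {H} [W nW|H1 H2 sh1 IH1 sh2 IH2 dis|H W shH IH nW dis] t stH le_t.
- have -> : FIset (Digraph W set0) = W.
    apply/setP => w; rewrite FIsetE inE /=; case: (w \in W) => //=.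
    by apply/eqP/setP => u; rewrite inE /= !in_set0.
  rewrite gen_isolated //; case: t le_t => [|t _].
    by rewrite leqn0 cards_eq0 (negPf nW).
  apply: eq_bigr => w wW; rewrite P_player // players_preds.
  have [_ pG _] := stH; rewrite pG //; apply/eqP/setP => u.
  by rewrite inE /= !in_set0.
- have st1 := stage_union1 sh1 sh2 dis stH; have st2 := stage_union2 sh1 sh2 dis stH.
  have [le1 le2] : #|vertices H1| <= t /\ #|vertices H2| <= t.
    by split; apply: leq_trans le_t; rewrite subset_leq_card /= ?subsetUl ?subsetUr.
  rewrite gen_union // FIset_union // -(IH1 t) // -(IH2 t) // prod_setU //.
  rewrite -setI_eq0; apply/eqP/setP => v; rewrite in_setI in_set0 !FIsetE !inE.
  by apply/negP => /andP[/andP[v1 _] /andP[]]; rewrite (disjointFr dis v1).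
have pW := stage_join_preds shH dis stH.
have twW := stage_join_twins _ shH nW dis stH.
have stH' := stage_join shH nW dis stH.
have /set0Pn[w0 w0W] := nW.
case: t le_t => [|t]; rewrite cardsU (disjoint_setI0 dis) cards0 subn0.
  by rewrite leqn0 addn_eq0 (cards_eq0 W) (negPf nW) andbF.
move=> le_t; have {le_t} le_t : #|vertices H| <= t.
  have : 0 < #|W| by rewrite card_gt0.
  by move: le_t; rewrite /=; lia.
have [l [pl ll uniql]] := leader_exists w0.
have lW : l \in W by rewrite -twW pl pW.
have nplW w : w \in W -> w \notin players Gam.
  by move=> wW; rewrite players_preds pW // FIset_neq0.
(* Followers contribute 1, so the product over [W] is the number of the leader [l]. *)
rewrite FIset_join // (bigD1 l) //= big1 ?muln1 => [|w /andP[wW ne_wl]]; last first.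
  rewrite P_follower ?nplW //; apply: contraNN ne_wl => lw.
  by apply/eqP; apply: uniql; rewrite ?pW.
have le_sum : \sum_(X : {set T} | X \subset vertices H) weight Gam ok z H X < y.
  exact: leq_ltn_trans (sum_weight_le _ _ _ z_gt0) y_large.
(* Both truncations are harmless, as the numbers of [H] and of the joined graph lie below [B]. *)
rewrite P_leader ?nplW // pW // (IH t) // (modn_small (gen_lt H)).
rewrite -[RHS](modn_small (gen_lt _)) gen_join //; congr (_ %% _).
apply: eq_bigr => a _; congr (y ^ _ * (_ * _)).
  by apply: eq_card => w; rewrite !inE eq_sym twW.
by apply: eq_bigl => w; rewrite eq_sym twW.
Qed.

Hypothesis shG : strong_hierarchical G.
Hypothesis vertices_full : vertices G = [set: T].

Lemma profile_rounds t : #|T| <= t ->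
  \sum_(a < #|T|.+1) ((\prod_(v | succs G v == set0) P t v) %% B %/ y ^ a) %% y =
  \sum_X weight Gam ok z G X.
Proof.
move=> le_t; have y_gt0 : 0 < y by apply: leq_ltn_trans y_large.
have -> : \prod_(v | succs G v == set0) P t v = gen Gam ok y z G.
  rewrite -(@prod_rounds G t) ?vertices_full ?cardsT //.
  by apply: eq_bigl => v; rewrite FIsetE inE vertices_full in_setT.
rewrite modn_small; last exact: leq_ltn_trans (gen_le _ _ _ z_gt0 y_gt0) B_large.
pose act X := #|FIset G :&: active Gam X|.
have actT X : act X < #|T|.+1 by rewrite ltnS max_card.
have fullP : xpredT =1 (fun X : {set T} => X \subset vertices G).
  by move=> X; rewrite vertices_full subsetT.
rewrite (eq_bigl _ _ fullP) (partition_big (fun X => Ordinal (actT X)) predT) //=.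
apply: eq_bigr => a _; rewrite weighted_digit.
  by apply: eq_bigl => X; rewrite -val_eqE.
exact: leq_ltn_trans (sum_weight_le _ _ _ z_gt0) y_large.
Qed.

End Rounds.

(** * Reading the satisfaction off the generating function *)

Section Agreement.
Variables (T : finType) (Gam : game_data T) (i : T) (d : bool) (z q : nat).

Let ok (v : T) (b : bool) := ~~ (v == i) || (b == d).

Lemma weight_full X : vertices (graph Gam) = [set: T] ->
  weight Gam ok z (graph Gam) X =
  ((i \in X) == d) * z ^ #|[set v | decides Gam X v]|.
Proof.
move=> full; rewrite /weight big_split full; congr (_ * _).
  rewrite (bigD1 i) ?in_setT //= /ok eqxx big1 ?muln1 // => v.
  by case/andP=> _ ->.
rewrite prod_exp_mem; congr (_ ^ _); apply: eq_card => v.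
by rewrite !inE.
Qed.

(** There are at most 2 ^ #|T| < z weights, each 0 or a power of z, so digit k counts the allowed
    sets with exactly k final decisions 1. The condition on k selects a collective decision equal to
    [d], which is also the actor's decision. *)
Lemma sum_agreement : vertices (graph Gam) = [set: T] -> 2 ^ #|T| < z ->
  \sum_(k < #|T|.+1 | (q <= k) == d)
    ((\sum_X weight Gam ok z (graph Gam) X) %/ z ^ k) %% z =
  #|[set X : {set T} | ((i \in X) == d) &&
                       ((q <= #|[set v | decides Gam X v]|) == d)]|.
Proof.
move=> full z_large; pose D X := #|[set v | decides Gam X v]|.
have -> : \sum_X weight Gam ok z (graph Gam) X =
    \sum_(X : {set T}) ((i \in X) == d) * z ^ D X.
  by apply: eq_bigr => X _; rewrite weight_full.
have DT X : D X < #|T|.+1 by rewrite ltnS max_card.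
rewrite -sum1_card; under [RHS]eq_bigl do rewrite inE.
rewrite [RHS](partition_big (fun X => Ordinal (DT X)) (fun k : 'I_#|T|.+1 => (q <= k) == d));
  last by move=> X /andP[].
apply: eq_bigr => k /eqP qk; rewrite weighted_digit /=; last first.
  apply: leq_ltn_trans z_large.
  apply: (@leq_trans (\sum_(X : {set T}) 1)); first by apply: leq_sum => X _; apply: leq_b1.
  rewrite sum1_card; apply: leq_trans (max_card _) _.
  by rewrite -cardsT -powersetT card_powerset cardsT.
rewrite [LHS]big_mkcond [RHS]big_mkcond; apply: eq_bigr => X _ /=.
rewrite -val_eqE /=; case: (eqVneq (D X) k) => [eqk|_]; last by rewrite andbF.
by rewrite -/(D X) eqk qk eqxx !andbT; case: (_ == d).
Qed.

End Agreement.

(** * Correctness of the algorithm *)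

Lemma value_bits_of_nat m : value (bits_of_nat m) = m.
Proof.
elim/ltn_ind: m => m IHm; case: (posnP m) => [->//|m_gt0].
rewrite -{1}[m]odd_double_half bits_of_nat_cons; last first.
  by case: m m_gt0 {IHm} => [|[|m]] //; rewrite addn_gt0.
by rewrite /= IHm ?odd_double_half //; case: m m_gt0 {IHm} => // m _; lia.
Qed.

(** For a monotone predicate the first hit is a threshold. If there is no hit, [find] returns n + 1,
    which exceeds every admissible [a], as it should. *)
Lemma find_iota_leq (p : pred nat) n a : a <= n ->
  (forall j k, j <= k -> k <= n -> p j -> p k) ->
  (find p (iota 0 n.+1) <= a) = p a.
Proof.
move=> le_an mono; apply/idP/idP => [le_fa|pa].
  have hasp : has p (iota 0 n.+1).
    by rewrite has_find size_iota; apply: leq_ltn_trans le_fa _; rewrite ltnS.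
  have := nth_find 0 hasp; rewrite nth_iota; last by apply: leq_ltn_trans le_fa _.
  exact: mono.
rewrite leqNgt; apply/negP => lt_af; have := before_find 0 lt_af.
by rewrite nth_iota ?pa.
Qed.

Lemma rank_leq n r a : a <= n -> (rank n r <= a) = (value r.1 <= a * value r.2).
Proof.
move=> le_an.
have pE b : b <= n -> le_bits r.1 (sum_bits (size r.2 + n) (iota 0 b) (fun=> r.2)) =
    (value r.1 <= b * value r.2).
  move=> le_bn; rewrite le_bitsP value_sum big_const_seq count_predT size_iota.
  (* The width in [rank] leaves n bits of room above [r.2], enough for b copies, so the sum is not
     truncated. *)
  have lt_b : b < 2 ^ n by apply: leq_ltn_trans le_bn (ltn_expl _ _).
  rewrite iter_addn_0 modn_small 1?mulnC // expnD mulnC.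
  apply: leq_ltn_trans (leq_mul (ltnW (value_lt r.2)) (leqnn b)) _.
  by rewrite ltn_pmul2l ?expn_gt0.
rewrite find_iota_leq // ?pE // => j k le_jk le_kn.
rewrite !pE // ?(leq_trans le_jk) // => /leq_trans; apply.
by rewrite leq_mul.
Qed.

Lemma rank_bits_of_nat n m a : a <= n ->
  (rank n (bits_of_nat m, [:: true]) <= a) = (m <= a).
Proof. by move=> le_an; rewrite rank_leq // value_bits_of_nat muln1. Qed.

Lemma rank_eq n m : m <= n -> rank n (bits_of_nat m, [:: true]) = m.
Proof.
move=> le_mn; apply/eqP; rewrite eqn_leq rank_bits_of_nat // leqnn /=.
case: m le_mn => // m le_mn; rewrite ltnNge rank_bits_of_nat ?ltnn //.
exact: ltnW.
Qed.

Lemma leq_label (r : rat) (k : nat) : (0 <= r)%R ->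
  (`|numq r|%N <= k * `|denq r|%N) = (r <= k%:R)%R.
Proof.
move=> r_ge0; rewrite -{3}[r]divq_num_den ler_pdivrMr ?ltr0z ?denq_gt0 //.
rewrite -[k%:R%R]/(k%:Z%:~R)%R -intrM ler_int -lez_nat PoszM.
by rewrite !gez0_abs ?numq_ge0 ?denq_ge0.
Qed.

Lemma big_iota (R : Type) (idx : R) (op : R -> R -> R) n (F : nat -> R) :
  \big[op/idx]_(x <- iota 0 n) F x = \big[op/idx]_(i < n) F i.
Proof. by rewrite -{1}(subn0 n) -/(index_iota 0 n) big_mkord. Qed.

Lemma count_iota (p : pred nat) n : count p (iota 0 n) = #|[set i : 'I_n | p i]|.
Proof. by rewrite -sum1_count big_mkcond big_iota -big_mkcond sum1dep_card. Qed.

Lemma all_iota (p : pred nat) n : all p (iota 0 n) = [forall i : 'I_n, p i].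
Proof.
apply/allP/forallP => [pP i|pP k]; first by apply: pP; rewrite mem_iota ltn_ord.
by rewrite mem_iota => lt_kn; apply: (pP (Ordinal lt_kn)).
Qed.

Lemma nth_map_enum A (d : A) n (F : 'I_n -> A) (i : 'I_n) :
  nth d [seq F j | j <- enum 'I_n] i = F i.
Proof. by rewrite (nth_map i) ?size_enum_ord // nth_ord_enum. Qed.

(** The same tree as [encode_instance], presented at a type on which the program is written. *)
Definition raw_of (a : sat_instance) : raw_instance :=
  let Gam := inst_game a in
  let V := enum 'I_(num_actors a) in
  ([seq [seq (i, j) \in arcs (graph Gam) | j <- V] | i <- V],
   ([seq (bits_of_nat `|numq (label Gam i)|, bits_of_nat `|denq (label Gam i)|)
       | i <- V],
    (bits_of_nat (quota Gam),
     ([seq i \in players Gam | i <- V], bits_of_nat (inst_actor a))))).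

Lemma enc_raw_of a : enc (raw_of a) = encode_instance a.
Proof.
rewrite /encode_instance /raw_of /enc /enc_prod /=; congr (Node _ (Node _ _)).
by rewrite /enc /enc_seq /encode_seq !foldr_map.
Qed.

(** * The bit program realises the abstract rounds *)

Section Correctness.
Variables (a : sat_instance) (d : bool).

Notation n := (num_actors a).
Notation Gam := (inst_game a).
Notation G := (graph Gam).
Notation f := (label Gam).
Notation c := (config_of (raw_of a) d).
Notation Z := (2 ^ zwidth c).
Notation Y := (2 ^ ywidth c).
Notation B := (2 ^ width c).

Let ok (v : 'I_n) (b : bool) := ~~ (v == inst_actor a) || (b == d).

Hypothesis game_ok : strong_hierarchical_game Gam.
Hypothesis label_gt0 : forall i : 'I_n, (0 < f i)%R.

Implicit Types (u v w : 'I_n).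

Lemma order_raw : order c = n.
Proof. by rewrite /order /= size_map size_enum_ord. Qed.

Lemma zwidth_raw : zwidth c = n.+1.
Proof. by rewrite /zwidth order_raw. Qed.

Lemma order_gt0 : 0 < n.
Proof. exact: leq_ltn_trans (leq0n _) (ltn_ord (inst_actor a)). Qed.

Lemma arc_raw u v : arc c u v = (u \in preds G v).
Proof. by rewrite /arc /= !nth_map_enum inE. Qed.

(** Labels are compared only with counts at most n, so an integer threshold loses nothing; a label
    above n becomes n + 1. *)
Lemma threshold_raw v k : k <= n -> (threshold c v <= k) = (f v <= k%:R)%R.
Proof.
move=> le_kn; rewrite /threshold /= -map_comp nth_map_enum /= size_map size_enum_ord.
by rewrite rank_leq // !value_bits_of_nat leq_label // ltW.
Qed.

Lemma is_player_raw v : is_player c v = (v \in players Gam).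
Proof. by rewrite /is_player /= nth_map_enum. Qed.

Lemma allowed_raw v b : allowed c v b = ok v b.
Proof.
rewrite /allowed /ok /= size_map size_enum_ord rank_eq //.
exact: ltnW.
Qed.

Lemma indegree_raw v : indegree c v = #|preds G v|.
Proof.
rewrite /indegree /indices order_raw count_iota; apply: eq_card => u.
by rewrite [in LHS]inE arc_raw.
Qed.

Lemma twins_raw v w : twins c v w = (preds G v == preds G w).
Proof.
rewrite /twins /indices order_raw all_iota; apply/forallP/eqP => [tw|eqp u].
  by apply/setP => u; have := tw u; rewrite !arc_raw => /eqP.
by rewrite !arc_raw eqp.
Qed.

Lemma leader_raw v :
  exists w, [/\ preds G w = preds G v, leader c w
    & forall u, preds G u = preds G v -> leader c u -> u = w].
Proof.
case: (@arg_minnP _ v (fun w => preds G w == preds G v) (fun w => w : nat) (eqxx _)).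
move=> w /eqP pw minw.
have leaderP u : preds G u = preds G v -> leader c u -> u <= w.
  move=> pu /allP; have [//|lt_wu] := leqP u w => /(_ w).
  by rewrite mem_iota lt_wu twins_raw pu pw eqxx => /(_ isT).
exists w; split=> // [|u pu lu].
  apply/allP => k; rewrite mem_iota add0n => /andP[_ lt_kw].
  have lt_kn : k < n by apply: ltn_trans lt_kw _.
  rewrite (twins_raw w (Ordinal lt_kn)); apply/negP => /eqP pk.
  have := minw (Ordinal lt_kn); rewrite -pk pw eqxx => /(_ isT) /=.
  by rewrite leqNgt lt_kw.
apply/val_inj/eqP; rewrite eqn_leq leaderP //=; apply: minw.
by rewrite pu.
Qed.

(** The actor guarantees n > 0, without which (n + 1) ^ 2 + (n + 1) + 1 < (n + 1) ^ 3 would fail. *)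
Lemma width_bound e0 e1 : e0 <= ywidth c + zwidth c -> e1 <= ywidth c + zwidth c ->
  2 ^ e0 + 2 ^ e1 < B.
Proof.
move=> le0 le1; apply: (@leq_ltn_trans (2 ^ (ywidth c + zwidth c).+1)).
  by rewrite expnS mul2n -addnn leq_add // leq_exp2l.
rewrite ltn_exp2l // /width /ywidth /zwidth order_raw.
by have := order_gt0; move: (n) => k; nia.
Qed.

Lemma value_choice v e0 e1 : e0 <= ywidth c + zwidth c -> e1 <= ywidth c + zwidth c ->
  value (choice_bits c v e0 e1) = ok v false * 2 ^ e0 + ok v true * 2 ^ e1.
Proof.
move=> le0 le1; have lt01 := width_bound le0 le1.
have [lt0 lt1] : e0 < width c /\ e1 < width c.
  split; rewrite -(@ltn_exp2l 2) //; apply: leq_ltn_trans lt01.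
    exact: leq_addr.
  exact: leq_addl.
have vE b e : e < width c ->
    value (if allowed c v b then pow_bits (width c) e else [::]) = ok v b * 2 ^ e.
  by rewrite allowed_raw => lte; case: ok; rewrite ?value_pow ?lte ?mul1n.
rewrite /choice_bits value_add !vE // modn_small //.
apply: leq_ltn_trans lt01; rewrite leq_add //; first by case: ok; rewrite ?mul1n.
by case: ok; rewrite ?mul1n.
Qed.

Lemma verdict_raw v m k b : k <= n -> m <= n ->
  verdict c v m k b = tipped Gam v k (m - k) b.
Proof.
move=> le_k le_m; rewrite /verdict /tipped !threshold_raw ?(leq_trans (leq_subr _ _)) //.
by rewrite -!ltNge.
Qed.

Lemma value_member m k w : k <= n -> m <= n ->
  value (member_bits c m k w) = member Gam ok Z m k w.
Proof.
move=> le_k le_m; have le_z b : (if b then zwidth c else 0) <= ywidth c + zwidth c.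
  by case: b => //; apply: leq_addl.
rewrite /member_bits value_choice ?le_z // !verdict_raw // /member.
by do 2!case: tipped; rewrite ?expn0 ?expn1.
Qed.

Definition vertex_value t v := value (nth [::] (rounds c t) v).

Lemma vertex_valueS t v : vertex_value t.+1 v = value (vertex_bits c (rounds c t) v).
Proof.
rewrite /vertex_value /rounds iterS /round_bits (nth_map 0) /indices order_raw.
  by rewrite nth_iota.
by rewrite size_iota.
Qed.

Lemma vertex_value_player t v : v \in players Gam ->
  vertex_value t.+1 v = ok v false + ok v true * (Z * Y).
Proof.
move=> vN; rewrite vertex_valueS /vertex_bits is_player_raw vN value_choice //.
by rewrite expn0 muln1 expnD [Z * Y]mulnC.
Qed.

Lemma vertex_value_follower t v : v \notin players Gam -> ~~ leader c v ->
  vertex_value t.+1 v = 1.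
Proof.
by move=> vN nl; rewrite vertex_valueS /vertex_bits is_player_raw (negPf vN) (negPf nl).
Qed.

Lemma value_below t v :
  value (below_bits c (rounds c t) v) = (\prod_(u in preds G v) vertex_value t u) %% B.
Proof.
rewrite /below_bits value_prod // /indices order_raw big_iota; congr (_ %% _).
rewrite [RHS]big_mkcond; apply: eq_bigr => u _; rewrite arc_raw.
by case: (u \in preds G v).
Qed.

Lemma activated_raw v k : k <= n ->
  activated c v k = #|[set w | (preds G v == preds G w) && (f w <= k%:R)%R]|.
Proof.
move=> le_k; rewrite /activated /indices order_raw count_iota; apply: eq_card => w.
by rewrite !inE twins_raw threshold_raw.
Qed.

Lemma vertex_value_leader t v : v \notin players Gam -> leader c v ->
  vertex_value t.+1 v = (\sum_(k < #|'I_n|.+1)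
    Y ^ #|[set w | (preds G v == preds G w) && (f w <= k%:R)%R]| *
    (((\prod_(u in preds G v) vertex_value t u) %% B %/ Y ^ k) %% Y *
     \prod_(w | preds G v == preds G w) member Gam ok Z #|preds G v| k w)) %% B.
Proof.
move=> vN lv; rewrite vertex_valueS /vertex_bits is_player_raw (negPf vN) lv.
have le_m : #|preds G v| <= n by rewrite -[leqRHS]card_ord max_card.
rewrite /group_bits value_sum {1}zwidth_raw.
rewrite big_iota card_ord -modn_summ -[RHS]modn_summ; congr (_ %% _).
apply: eq_bigr => k _; have le_k : k <= n by rewrite -ltnS.
rewrite value_mul value_mul modn_mod modnMmr value_digit value_below value_pow.
(* [pow_bits] yields 0 unless the exponent is below the width; here it is at most n * [ywidth],
   while the width is (n + 1) * [ywidth]. *)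
rewrite activated_raw // ifT -?expnM; last first.
  rewrite mulnC ltn_pmul2r // /zwidth order_raw ltnS -[leqRHS]card_ord.
  exact: max_card.
rewrite value_prod // mulnA modnMmr -mulnA; congr ((_ * (_ %/ _ %% _ * _)) %% _).
  by rewrite -?expnM mulnC.
rewrite /indices order_raw big_iota [RHS]big_mkcond; apply: eq_bigr => w _.
rewrite twins_raw indegree_raw; case: ifP => // _.
by rewrite value_member.
Qed.

Let shG : strong_hierarchical G. Proof. by case: game_ok. Qed.

Let vertices_full : vertices G = [set: 'I_n].
Proof. by case: game_ok => -[]. Qed.

Lemma players_preds v : (v \in players Gam) = (preds G v == set0).
Proof.
case: game_ok => _ _ ->; rewrite !inE vertices_full in_setT /=.
by case: (preds G v == set0); case: (succs G v == set0).
Qed.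

Lemma Z_large : 2 ^ #|'I_n| < Z.
Proof. by rewrite card_ord zwidth_raw ltn_exp2l. Qed.

Lemma Y_large : 2 ^ #|'I_n| * Z ^ #|'I_n| < Y.
Proof.
rewrite card_ord -expnM -expnD ltn_exp2l // /ywidth zwidth_raw.
by move: (n) => k; nia.
Qed.

Lemma B_large : 2 ^ #|'I_n| * Z ^ #|'I_n| * Y ^ #|'I_n| < B.
Proof.
rewrite card_ord -!expnM -!expnD ltn_exp2l // /width /ywidth zwidth_raw.
by move: (n) => k; nia.
Qed.

Lemma value_profile : value (profile_bits c) = \sum_X weight Gam ok Z G X.
Proof.
have lt_sum : \sum_X weight Gam ok Z G X < B.
  have fullP : xpredT =1 (fun X : {set 'I_n} => X \subset vertices G).
    by move=> X; rewrite vertices_full subsetT.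
  rewrite (eq_bigl _ _ fullP).
  apply: leq_ltn_trans (sum_weight_le _ _ _ _) _; first by rewrite expn_gt0.
  by apply: leq_ltn_trans B_large; rewrite leq_pmulr // !expn_gt0.
rewrite -(modn_small lt_sum).
rewrite -(@profile_rounds _ Gam ok Y Z B (leader c) vertex_value _ _ _ _ _ _ _ _ _ _ _ n);
  rewrite ?card_ord ?expn_gt0 //.
- rewrite /profile_bits value_sum {1}zwidth_raw big_iota; congr (_ %% _).
  apply: eq_bigr => k _; rewrite value_digit -expnM mulnC; congr (_ %/ _ %% _).
  rewrite /total_bits value_prod // /indices order_raw big_iota; congr (_ %% _).
  rewrite [RHS]big_mkcond; apply: eq_bigr => v _.
  have -> : all (fun w : nat => ~~ arc c v w) (iota 0 n) = (succs G v == set0).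
    rewrite all_iota; apply/forallP/eqP => [none|succ0 w].
      by apply/setP => w; rewrite mem_succs in_set0 -arc_raw; apply/negbTE/none.
    by rewrite arc_raw -mem_succs succ0 in_set0.
  by case: ifP => // _; rewrite /final_bits order_raw.
- exact: players_preds.
- by have := Y_large; rewrite card_ord.
- by have := B_large; rewrite card_ord.
- exact: leader_raw.
- exact: vertex_value_player.
- exact: vertex_value_follower.
- by move=> t v vN lv; rewrite (vertex_value_leader _ vN lv) card_ord.
Qed.

Lemma value_agreement :
  value (agreement_bits c (rank n (bits_of_nat (quota Gam), [:: true]))) =
  #|[set X : {set 'I_n} | ((inst_actor a \in X) == d) &&
      ((quota Gam <= #|[set v | decides Gam X v]|) == d)]|.
Proof.
rewrite /agreement_bits value_sum {1}zwidth_raw big_iota.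
rewrite -(sum_agreement _ _ _ vertices_full Z_large) card_ord.
have agr_le : \sum_(k < n.+1 | (quota Gam <= k) == d)
    ((\sum_X weight Gam ok Z G X) %/ Z ^ k) %% Z < B.
  have := sum_agreement (inst_actor a) d (quota Gam) vertices_full Z_large.
  rewrite card_ord => ->.
  apply: leq_ltn_trans (max_card _) _.
  rewrite -cardsT -powersetT card_powerset cardsT.
  apply: leq_ltn_trans B_large; rewrite -mulnA leq_pmulr //.
  by rewrite muln_gt0 !expn_gt0.
rewrite -[RHS](modn_small agr_le); congr (_ %% _).
rewrite [RHS]big_mkcond; apply: eq_bigr => k _.
rewrite rank_bits_of_nat; last by rewrite -ltnS.
by case: ifP => // _; rewrite value_digit value_profile -expnM mulnC.
Qed.

End Correctness.

(** A player has no predecessors and a positive label, so influence never activates it and it lies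
    in the spread only by its own decision. *)
Lemma final_decisionE (T : finType) (Gam : game_data T) (x : {ffun T -> bool}) v :
  (forall v, (v \in players Gam) = (preds (graph Gam) v == set0)) ->
  (forall v, 0 < label Gam v)%R ->
  final_decision Gam x v = decides Gam (ones x) v.
Proof.
move=> playersE label_gt0.
rewrite /final_decision /decides; case: ifP => [vN|_]; last first.
  by rewrite /tipped /active_preds /inactive_preds setIC inE.
rewrite mem_spread; move: vN; rewrite playersE => /eqP ->.
by rewrite set0I cards0 leNgt label_gt0 orbF.
Qed.

Lemma card_ones (T : finType) (p : pred {set T}) :
  #|[set x : {ffun T -> bool} | p (ones x)]| = #|[set X | p X]|.
Proof.
have onesK : cancel (fun X : {set T} => [ffun v => v \in X]) (@ones T).
  by move=> X; apply/setP => v; rewrite inE ffunE.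
have chiK : cancel (@ones T) (fun X : {set T} => [ffun v => v \in X]).
  by move=> x; apply/ffunP => v; rewrite ffunE inE.
rewrite -(@on_card_preimset _ _ (@ones T)); last first.
  by apply: onW_bij; exists (fun X : {set T} => [ffun v => v \in X]).
by apply: eq_card => x; rewrite !inE.
Qed.

Lemma solve_correct (a : sat_instance) :
  strong_hierarchical_game (inst_game a) ->
  (forall i : 'I_(num_actors a), 0 < label (inst_game a) i)%R ->
  solve (raw_of a) = bits_of_nat (satisfaction (inst_game a) (inst_actor a)).
Proof.
move=> game_ok label_gt0; rewrite /solve trim_value value_add; congr bits_of_nat.
have -> : size (raw_of a).1 = num_actors a by rewrite size_map size_enum_ord.
have -> : (raw_of a).2.2.1 = bits_of_nat (quota (inst_game a)) by [].
set S := satisfaction _ _.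
pose A d := [set X : {set 'I_(num_actors a)} | ((inst_actor a \in X) == d) &&
  ((quota (inst_game a) <= #|[set v | decides (inst_game a) X v]|) == d)].
transitivity ((#|A true| + #|A false|) %% 2 ^ width (config_of (raw_of a) true)).
  by congr ((_ + _) %% _); apply: value_agreement.
have -> : #|A true| + #|A false| = S.
  rewrite /S /satisfaction /A.
  have -> : #|[set x : {ffun 'I_(num_actors a) -> bool} |
      collective_decision (inst_game a) x == x (inst_actor a)]| =
    #|[set X : {set 'I_(num_actors a)} |
      (quota (inst_game a) <= #|[set v | decides (inst_game a) X v]|) ==
      (inst_actor a \in X)]|.
    rewrite -card_ones; apply: eq_card => x; rewrite !inE /collective_decision.
    congr ((_ <= _) == _); apply: eq_card => v; rewrite !inE.
    by rewrite final_decisionE //; apply: players_preds.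
  (* Splitting by the actor's decision gives the two counts computed with that decision fixed to 1
     and to 0. *)
  rewrite -(cardsID [set X : {set 'I_(num_actors a)} | inst_actor a \in X] [set X | _ == _]).
  congr (_ + _); apply: eq_card => X; rewrite !inE.
    by case: (inst_actor a \in X); rewrite ?andbT ?andbF.
  by case: (inst_actor a \in X); rewrite ?andbT ?andbF.
rewrite modn_small //; apply: leq_ltn_trans (max_card _) _.
rewrite card_ffun card_bool; apply: leq_ltn_trans (B_large a true).
by rewrite -mulnA leq_pmulr // muln_gt0 !expn_gt0.
Qed.

Local Open Scope ring_scope.

Theorem theorem4 :
  poly_time_computable encode_instance encode_nat
    (fun a : sat_instance =>
       strong_hierarchical_game (inst_game a) /\
       (forall i : 'I_(num_actors a), 0 < label (inst_game a) i))
    (fun a : sat_instance => satisfaction (inst_game a) (inst_actor a)).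
Proof.
have [c [b [T [_ [k le_T] ex]]]] := ptime_solve.
(* The polynomial is the bound of [pbounded], with the input size as indeterminate. *)
exists c, (('X + 1) ^+ k)%R => a [game_ok label_gt0].
have [|t [s [exc le_t s0]]] := ex (raw_of a) (init_store (encode_instance a)).
  by rewrite enc_raw_of.
exists t, s; split=> //; first by rewrite s0 solve_correct.
apply: leq_trans le_t (leq_trans (le_T _) _).
rewrite /sz enc_raw_of horner_exp hornerD hornerX hornerC.
by rewrite -[(_ + 1)%R]/(_ + 1)%N addn1 natrXE.
Qed.
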